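(* Let $d\ge2$ and let $\Phi\in\mathsf C^3\big(\overline{\mathcal C^{(d-1)}_\rho}\big)$ be real-valued, with some $\rho>0$. Then for any $l=1,2,\dots,d$ the following statements hold: (1) For almost all $\hat{\mathbf x}\in\mathcal C^{(d-1)}_\rho$: (a) the set $\mathsf X_l(\hat{\mathbf x})$ is finite; (b) $\mathsf X_l(\hat{\mathbf x})=\mathsf X_l^{(\pm)}(\hat{\mathbf x})$ (for both signs); (c) the disjoint open intervals forming $\mathsf\Lambda_l^{(\pm)}(\hat{\mathbf x})$ have distinct endpoints (for both signs). (2) For any $\delta\in(0,2)$ the function $m_\delta(\mathsf X_l(\hat{\mathbf x}))$ satisfies the bound $$\int_{\mathcal C^{(d-1)}_\rho}m_\delta(\mathsf X_l(\hat{\mathbf x}))\,d\hat{\mathbf x}\le C\rho^{d-1-\delta}\big(1+\rho\|\nabla^2\Phi\|_{L^\infty}+\rho^2\|\nabla^3\Phi\|_{L^\infty}\big),$$ where the constant $C$ depends only on $\delta$ and the dimension $d$.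
   Context: $\mathcal C^{(n)}_\rho=(-2\rho,2\rho)^n$. For $\mathbf x=(x_1,\dots,x_d)$ write $\hat{\mathbf x}=(x_1,\dots,x_{d-1})$ and, for the fixed index $l$, $\overset{\circ}{\mathbf x}=(x_1,\dots,x_{l-1},x_{l+1},\dots,x_d)$. For $\hat{\mathbf x}\in\mathcal C^{(d-1)}_\rho$ put $$\mathsf X_l(\hat{\mathbf x})=\{x_d\in(-2\rho,2\rho):\ \Phi(\overset{\circ}{\mathbf x})=x_l\},\qquad \mathsf\Lambda^{(\pm)}_l(\hat{\mathbf x})=\{x_d\in(-2\rho,2\rho):\ \pm x_l>\pm\Phi(\overset{\circ}{\mathbf x})\}.$$ The set $\mathsf\Lambda^{(\pm)}_l(\hat{\mathbf x})$ is open, so it is empty or an at most countable union of disjoint open intervals; $\mathsf X^{(\pm)}_l(\hat{\mathbf x})$ denotes the set of all endpoints of these intervals lying strictly inside $(-2\rho,2\rho)$. For a finite set $\mathsf X\subset(-2\rho,2\rho)$ and $\delta\ge0$: $m_\delta(\varnothing)=(4\rho)^{-\delta}$; if $\mathsf X=\{\xi_1<\dots<\xi_N\}$, $N\ge1$, then $m_\delta(\mathsf X)=\sum_{j=1}^N\rho_j^{-\delta}$, where $\rho_j=\operatorname{dist}\{\xi_j,\mathsf X\setminus\{\xi_j\}\}$ if $N\ge2$ and $\rho_1=4\rho$ if $N=1$. The $L^\infty$ norms are over $\mathcal C^{(d-1)}_\rho$, and $|\nabla^kf|^2=\sum_{j_1,\dots,j_k}|\partial_{j_1}\cdots\partial_{j_k}f|^2$.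 *)

(* Defs.v *)
From HB Require Import structures.
From mathcomp Require Import all_boot all_order all_algebra.
From mathcomp Require Import all_classical all_reals all_analysis.

Set Implicit Arguments.
Unset Strict Implicit.
Unset Printing Implicit Defensive.
Import Order.TTheory GRing.Theory Num.Theory.
Import numFieldNormedType.Exports.
Local Open Scope classical_set_scope.
Local Open Scope ring_scope.

Definition rV_display : measure_display -> measure_display.
Proof. exact. Qed.

(* The product sigma-algebra, generated by the coordinate projections, as the
   library does for tuples; over the reals it is the Borel sigma-algebra. *)
Section measurable_rV.
Context {d} {T : sigmaRingType d}.
Variable n : nat.

Let coor : 'I_n -> 'rV[T]_n -> T := fun i x => x ord0 i.

Let rV_set0 : g_sigma_preimage coor set0.
Proof. exact: sigma_algebra0. Qed.

Let rV_setC A : g_sigma_preimage coor A -> g_sigma_preimage coor (~` A).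
Proof. exact: sigma_algebraC. Qed.

Let rV_bigcup (F : _^nat) : (forall i, g_sigma_preimage coor (F i)) ->
  g_sigma_preimage coor (\bigcup_i (F i)).
Proof. exact: sigma_algebra_bigcup. Qed.

HB.instance Definition _ := @isMeasurable.Build (rV_display d)
  'rV[T]_n (g_sigma_preimage coor) rV_set0 rV_setC rV_bigcup.

End measurable_rV.

Section measurable_rV_maps.
Context d d' (S : measurableType d') (T : measurableType d) (n : nat).

Lemma measurable_coord (i : 'I_n) :
  measurable_fun [set: 'rV[T]_n] (fun x : 'rV[T]_n => x ord0 i).
Proof.
move=> _ Y mY; rewrite setTI; apply: sub_sigma_algebra => /=.
rewrite -bigcup_seq/=; exists i => /=; first by rewrite mem_index_enum.
by exists Y => //; rewrite setTI.
Qed.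

Lemma measurable_fun_rV (f : S -> 'rV[T]_n) :
  (forall i, measurable_fun [set: S] (fun x => f x ord0 i)) ->
  measurable_fun [set: S] f.
Proof.
move=> mf; apply: measurability => //.
move=> _ [A + <-]; rewrite -bigcup_seq/= => -[i _ [B mB <-]].
by rewrite !setTI; have := mf i measurableT B mB; rewrite setTI.
Qed.

End measurable_rV_maps.

Section lebesgue_rV.
Context {R : realType}.

Definition consrV n (p : measurableTypeR R * 'rV[R]_n) : 'rV[R]_n.+1 :=
  \row_(i < n.+1) oapp (p.2 ord0) p.1 (unlift ord0 i).

Lemma consrV0 n p : @consrV n p ord0 ord0 = p.1.
Proof. by rewrite mxE unlift_none. Qed.

Lemma consrVS n p (j : 'I_n) : consrV p ord0 (lift ord0 j) = p.2 ord0 j.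
Proof. by rewrite mxE liftK. Qed.

Let measurable_idR : measurable_fun setT (idfun : measurableTypeR R -> R).
Proof. by move=> _ Y mY; rewrite setTI. Qed.

Lemma measurable_consrV n : measurable_fun [set: measurableTypeR R * 'rV[R]_n] (@consrV n).
Proof.
apply: measurable_fun_rV => i; have [j ->|->] := unliftP ord0 i.
  under eq_fun do rewrite consrVS.
  exact: (measurableT_comp (measurable_coord j) measurable_snd).
by under eq_fun do rewrite consrV0; exact: (measurableT_comp measurable_idR measurable_fst).
Qed.

HB.instance Definition _ n := isMeasurableFun.Build _ _ _ _
  (@consrV n) (@measurable_consrV n).

Let splitrV n (x : 'rV[R]_n.+1) : measurableTypeR R * 'rV[R]_n :=
  (x ord0 ord0, \row_j x ord0 (lift ord0 j)).

Let consrVK n : cancel (@consrV n) (@splitrV n).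
Proof.
move=> [t v]; rewrite /splitrV consrV0; congr (_, _).
by apply/rowP => j; rewrite mxE consrVS.
Qed.

Let measurable_splitrV n : measurable_fun [set: 'rV[R]_n.+1] (@splitrV n).
Proof.
apply: measurable_fun_pair.
  by move=> _ Y mY; exact: (measurable_coord ord0 measurableT mY).
apply: measurable_fun_rV => i; under eq_fun do rewrite mxE.
exact: measurable_coord.
Qed.

Section step.
Local Open Scope ereal_scope.
Variables (n : nat) (mu : {sigma_finite_measure set 'rV[R]_n -> \bar R}).

Definition lebesgue_rV_step : set 'rV[R]_n.+1 -> \bar R :=
  pushforward (@lebesgue_measure R \x mu) (@consrV n).

Let step0 : lebesgue_rV_step set0 = 0.
Proof. by rewrite /lebesgue_rV_step /pushforward preimage_set0 measure0. Qed.

Let step_ge0 A : 0 <= lebesgue_rV_step A.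
Proof. exact: measure_ge0. Qed.

Let step_sigma_additive : semi_sigma_additive lebesgue_rV_step.
Proof.
exact: measure_semi_sigma_additive.
Qed.

HB.instance Definition _ := isMeasure.Build _ _ _ lebesgue_rV_step
  step0 step_ge0 step_sigma_additive.

Let step_sigma_finite : sigma_finite setT lebesgue_rV_step.
Proof.
have /sigma_finiteP[F [TF ndF Foo]] := sigma_finiteT (@lebesgue_measure R).
have /sigma_finiteP[G [TG ndG Goo]] := sigma_finiteT mu.
exists (fun k => @splitrV n @^-1` (F k `*` G k)).
  rewrite -preimage_bigcup -[LHS](preimage_setT (@splitrV n)); congr (_ @^-1` _).
  rewrite -setXTT TF TG predeqE => -[x y]; split.
    move=> [/= [i _ Fix] [k _ Gky]]; exists (maxn i k) => //; split.
    - by move: x Fix; exact/subsetPset/ndF/leq_maxl.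
    - by move: y Gky; exact/subsetPset/ndG/leq_maxr.
  by move=> [i _ []/= ? ?]; split; exists i.
move=> k; have [mF Fk] := Foo k; have [mG Gk] := Goo k; split.
  rewrite -[X in measurable X]setTI; apply: measurable_splitrV => //.
  exact: measurableX.
rewrite /lebesgue_rV_step /pushforward -comp_preimage.
rewrite (_ : _ \o _ = id) ?preimage_id; last first.
  by apply/funext => x /=; rewrite consrVK.
by rewrite product_measure1E// lte_mul_pinfty// ge0_fin_numE.
Qed.

HB.instance Definition _ := Measure_isSigmaFinite.Build _ _ _
  lebesgue_rV_step step_sigma_finite.

End step.

Fixpoint lebesgue_rV n : {sigma_finite_measure set 'rV[R]_n -> \bar R} :=
  match n with
  | 0 => dirac (0 : 'rV[R]_0)
  | k.+1 => lebesgue_rV_step (lebesgue_rV k)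
  end.

Let box n (a b : 'rV[R]_n) : set 'rV[R]_n :=
  [set x | forall i, a ord0 i < x ord0 i < b ord0 i].

Let measurable_box n (a b : 'rV[R]_n) : measurable (box a b).
Proof.
rewrite (_ : box a b = \bigcap_(i in [set: 'I_n])
    ((fun x : 'rV[R]_n => x ord0 i) @^-1` `]a ord0 i, b ord0 i[)).
  apply: fin_bigcap_measurable => // i _.
  by rewrite -[X in measurable X]setTI; exact: measurable_coord.
by apply/seteqP; split=> x /= abx i => [_|]; have := abx i; rewrite /= in_itv/=;
  [|apply].
Qed.

Lemma lebesgue_rV_box n (a b : 'rV[R]_n) :
  (forall i, a ord0 i <= b ord0 i) ->
  lebesgue_rV n [set x : 'rV[R]_n | forall i, a ord0 i < x ord0 i < b ord0 i]
    = (\prod_(i < n) (b ord0 i - a ord0 i))%:E.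
Proof.
elim: n a b => [a b _|n IH a b ab].
  rewrite big_ord0 /= diracE mem_set//=.
  by case.
pose tl (c : 'rV[R]_n.+1) : 'rV[R]_n := \row_j c ord0 (lift ord0 j).
rewrite big_ord_recl /= /lebesgue_rV_step /pushforward.
rewrite (_ : _ @^-1` _ = `]a ord0 ord0, b ord0 ord0[ `*` box (tl a) (tl b)).
  rewrite product_measure1E//; last exact: measurable_box.
  rewrite EFinM; congr (_ * _)%E.
    apply: etrans (lebesgue_measure_itv `]a ord0 ord0, b ord0 ord0[) _ => /=.
    rewrite lte_fin; case: ltP => [_|ba]; first by rewrite -EFinD.
    by rewrite (@le_anti _ _ (a ord0 ord0) (b ord0 ord0)) ?ab ?ba ?subrr.
  have tlab i : tl a ord0 i <= tl b ord0 i by rewrite !mxE.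
  apply: etrans (IH _ _ tlab) _.
  by congr (_%:E); apply: eq_bigr => i _; rewrite !mxE.
apply/seteqP; split=> [[t v] /= abx|[t v] /= [abt abv] i].
  split; first by have := abx ord0; rewrite consrV0 in_itv.
  by move=> i; have := abx (lift ord0 i); rewrite consrVS !mxE.
have [j ->|->] := unliftP ord0 i; last by rewrite consrV0; rewrite in_itv in abt.
by rewrite consrVS; have := abv j; rewrite !mxE.
Qed.

End lebesgue_rV.

Definition ae_measurable {d} {T : measurableType d} {R : realType}
    (mu : {measure set T -> \bar R}) (D : set T) (f : T -> R) : Prop :=
  exists2 g : T -> R, measurable_fun D g & f = g %[ae mu in D].

Section smoothness.
Context {R : realType} {n : nat}.
Implicit Types (A : set 'rV[R]_n) (f : 'rV[R]_n -> R).

Definition partial (i : 'I_n) f : 'rV[R]_n -> R := 'D_(delta_mx ord0 i) f.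

Definition partials (s : seq 'I_n) f : 'rV[R]_n -> R := foldr partial f s.

(* [f] is of class C^k on the closure of the open set [A]: it is continuous
   there, its partial derivatives of order at most [k] exist in [A], and each
   of them is the restriction to [A] of a function continuous on the closure. *)
Definition Ck_closure (k : nat) A f : Prop :=
  [/\ {within closure A, continuous f},
      forall (s : seq 'I_n) (i : 'I_n) (x : 'rV[R]_n), (size s < k)%N -> A x ->
        derivable (partials s f) x (delta_mx ord0 i)
    & forall s : seq 'I_n, (size s <= k)%N ->
        exists2 g : 'rV[R]_n -> R, {within closure A, continuous g}
          & {in A, g =1 partials s f}].

Definition grad_norm (k : nat) f (x : 'rV[R]_n) : R :=
  Num.sqrt (\sum_(s : k.-tuple 'I_n) partials s f x ^+ 2).

Definition Linfty_norm A f : \bar R :=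
  ('N[lebesgue_rV n]_+oo [ (EFin \o f) \_ A ])%E.

End smoothness.

Definition cube {R : realType} (n : nat) (rho : R) : set 'rV[R]_n :=
  [set x | forall i, - (2 * rho) < x ord0 i < 2 * rho].
Arguments cube {R} n rho.

Section level_sets.
Context {R : realType} {d : nat}.
Variables (rho : R) (Phi : 'rV[R]_d.-1 -> R) (l : 'I_d) (xh : 'rV[R]_d.-1).

(* The point [(xh, t)]; [d.-1] is used for [d - 1], so this is meaningful for
   [0 < d]. *)
Definition append_last (t : R) : 'rV[R]_d :=
  \row_(i < d) oapp (xh ord0) t (insub (val i)).

(* [Phi] evaluated at [(xh, t)] with the [l]-th coordinate deleted. *)
Definition Phi_at (t : R) : R := Phi (col' l (append_last t)).

Definition X_set : set R :=
  [set t | - (2 * rho) < t < 2 * rho /\ Phi_at t = append_last t ord0 l].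

(* The sign is [+] for [s = false] and [-] for [s = true]. *)
Definition Lambda_set (s : bool) : set R :=
  [set t | - (2 * rho) < t < 2 * rho /\
           (-1) ^+ s * append_last t ord0 l > (-1) ^+ s * Phi_at t].

End level_sets.

(* [`]a, b[] is one of the disjoint open intervals forming the open set [A]. *)
Definition component_itv {R : realType} (A : set R) (a b : R) : Prop :=
  exists2 x, A x & connected_component A x = [set` `]a, b[].

Definition X_endpoints {R : realType} {d : nat} (rho : R)
    (Phi : 'rV[R]_d.-1 -> R) (l : 'I_d) (xh : 'rV[R]_d.-1) (s : bool) : set R :=
  [set t | - (2 * rho) < t < 2 * rho /\
     exists a b, component_itv (Lambda_set rho Phi l xh s) a b /\
                 (t = a \/ t = b)].

Definition distinct_endpoints {R : realType} (A : set R) : Prop :=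
  forall a b a' b' : R, component_itv A a b -> component_itv A a' b' ->
    (a, b) <> (a', b') -> [/\ a <> a', a <> b', b <> a' & b <> b'].

Definition gap {R : realType} (rho : R) (X : set R) (xi : R) : R :=
  if X `\ xi == set0 then 4 * rho
  else inf [set `|xi - eta| | eta in X `\ xi].

(* Only meaningful for finite [X]; a junk real number when [X] is infinite. *)
Definition mdelta {R : realType} (rho delta : R) (X : set R) : R :=
  if X == set0 then (4 * rho) `^ (- delta)
  else \sum_(xi \in X) gap rho X xi `^ (- delta).

(* Main.v *)
Require Import Defs.
From mathcomp Require Import all_boot all_order all_algebra finmap.
From mathcomp Require Import all_classical all_reals all_analysis.
From mathcomp Require Import measurable_realfun ess_sup_inf ring lra.

(** For l = d the level set has at most one point and everything is explicit.
    For l < d write xh = (y, c) with c = x_l and let phi_y be the restriction of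
    Phi to the line through y parallel to the last axis. The level set over xh
    is then the level set phi_y = c of a function of one variable, and c is
    integrated as well: for almost every c it is a regular value, and sums over
    the level set are controlled, on average in c, by integrals of |phi_y'|.

    Qualitative part. Call xh good if |phi_y - c| + |phi_y'| is bounded below on
    the open interval. The values c that are bad for a given y are limits of
    almost critical values, and they form a null set by the argument of Sard
    (sard_null). At a good point the zeros of phi_y - c are simple and
    uniformly apart, so they are finitely many, the sign changes at each of
    them, and no two components of a sign set meet (regular_level_sets).

    The bound. Let w = 4 rho and h_k = w / 2^k. A dyadic decomposition bounds
    mdelta by w^(-delta) times 1 plus the sum over k of 2^((k+1) delta) times
    the number of points of the level set having another one within h_k
    (mdelta_layers). Two such points share one of 2^k windows of width 2 h_k,
    and by Rolle this window contains a critical point of phi_y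
    (crowded_window). In a critical window |phi_y'| <= 2 h_k S with S a bound
    of |phi_y''| there, so the number of points of the level set in it has an
    integral over c of order h_k^2 S (slots_int). Between critical windows that
    do not overlap phi_y'' has a zero, so S is at most the third derivative
    times a distance; these distances telescope, and the sum of S over all
    critical windows is of order sup |phi_y''| + rho sup |phi_y'''|, whatever k is
    (slope_sum). The k-th layer therefore integrates to a multiple of
    2^(k (delta - 2)), which is summable as delta < 2.

    Counting functions are never integrated as such: a level set is counted by
    testing the midpoints of N small cells, which gives a finite sum of
    indicators of intervals in c (majorant), and N goes to infinity by Fatou's
    lemma (int_le_fatou). For measurability, moving each point of the level set
    to the middle of its cell gives a function of finitely many measurable
    events, and this function tends to mdelta as the mesh goes to 0
    (mdelta_round_cvg, measurable_mdelta_roots). Fubini's theorem along the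
    coordinate l (integral_insert_coord) assembles the lines. *)

Set Implicit Arguments.
Unset Strict Implicit.
Unset Printing Implicit Defensive.
Import Order.TTheory GRing.Theory Num.Theory.
Import numFieldNormedType.Exports.
Local Open Scope classical_set_scope.
Local Open Scope ring_scope.

(** * Components of bounded open sets of the line *)

Section components.
Context {R : realType}.
Implicit Types (A : set R) (a b x : R).

Lemma open_connected_component A x : open A -> open (connected_component A x).
Proof.
move=> oA; rewrite openE => z Cz.
have /nbhs_ballP[e /= e0 zeA] : nbhs z A.
  by apply: open_nbhs_nbhs; split => //; exact: connected_component_sub Cz.
rewrite (same_connected_component Cz); apply/nbhs_ballP; exists e => //= y zy.
apply: connected_component_max zy => //; first exact: ballxx.
by rewrite ball_itv; apply/connected_intervalP/interval_is_interval.
Qed.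

(** A component is open by local connectedness, so it is an open interval. *)
Lemma bounded_open_component A lo hi x :
  open A -> A `<=` `]lo, hi[ -> A x ->
  exists a b, [/\ a < x < b, connected_component A x = [set` `]a, b[], ~ A a & ~ A b].
Proof.
move=> oA Alh Ax; set C := connected_component A x.
have iC : is_interval C.
  by apply/connected_intervalP; exact: component_connected.
have CA : C `<=` A by exact: connected_component_sub.
have Cx : C x by exact: connected_component_refl.
have CE : C = [set` `]inf C, sup C[].
  rewrite -interval_bounded_interior//.
  - by apply/esym/interior_id; exact: open_connected_component.
  - by exists lo => y /CA/Alh /=; rewrite in_itv/= => /andP[/ltW].
  - by exists hi => y /CA/Alh /=; rewrite in_itv/= => /andP[_ /ltW].
have Cin y : C y <-> inf C < y < sup C by rewrite {1}CE /= in_itv.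
have /andP[ax xb] := (Cin x).1 Cx.
(* an endpoint lying in the open set would extend the component past itself *)
have ext y : A y -> (y = inf C \/ y = sup C) -> False.
  move=> Ay yab; have /nbhs_ballP[e /= e0 yeA] : nbhs y A.
    exact: open_nbhs_nbhs.
  have cB : connected (ball y e).
    by rewrite ball_itv; apply/connected_intervalP/interval_is_interval.
  suff [z [Cz yz]] : exists z, C z /\ ball y e z.
    have : C y.
      rewrite /C (same_connected_component Cz).
      by apply: (connected_component_max yz yeA cB); exact: ballxx.
    by move=> /Cin; case: yab => ->; rewrite ltxx ?andbF.
  case: yab => ->.
    exists (Num.min x (inf C + e / 2)); split.
      by apply/Cin; rewrite lt_min gt_min ax xb ltrDl divr_gt0.
    rewrite /ball/= ltr_norml; case: (lerP x (inf C + e / 2)) => h; lra.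
  exists (Num.max x (sup C - e / 2)); split.
    by apply/Cin; rewrite lt_max gt_max ax xb gtrBl divr_gt0.
  rewrite /ball/= ltr_norml; case: (lerP x (sup C - e / 2)) => h; lra.
exists (inf C), (sup C); split => //; first by rewrite ax xb.
- by move=> /ext; apply; left.
- by move=> /ext; apply; right.
Qed.

Lemma itvoo_inj (a b a' b' : R) : a < b ->
  [set` `]a, b[] = [set` `]a', b'[] -> a = a' /\ b = b'.
Proof.
move=> ab E; have E' x : (a < x < b) = (a' < x < b').
  by have := congr1 (fun S : set R => S x) E; rewrite /= !in_itv/= => h;
    apply/idP/idP; rewrite h.
have a'b' : a' < b'.
  have := E' ((a + b) / 2).
  by rewrite midf_lt//= midf_lt// => /esym/andP[]; exact: lt_trans.
by split; [have := congr1 inf E|have := congr1 sup E];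
  rewrite ?inf_itv ?sup_itv ?bnd_simp.
Qed.

End components.

(** * Functions whose zeros are simple *)

Section regular_functions.
Context {R : realType}.
Variables lo hi : R.
Implicit Types (F f : R -> R).

(** The quantitative form of transversality: the zeros of F are simple,
    uniformly up to the ends of the interval. *)
Definition regular_on F f :=
  exists2 e : R, 0 < e & forall t, lo < t < hi -> e <= `|F t| + `|f t|.

Lemma regular_onN F f : regular_on F f -> regular_on (\- F) (\- f).
Proof. by move=> [e e0 H]; exists e => // t /H /=; rewrite !normrN. Qed.

Lemma pos_deriv_sign F (t0 d : R) : is_derive t0 1 F d -> F t0 = 0 -> 0 < d ->
  exists2 r : R, 0 < r & (forall t, t0 < t < t0 + r -> 0 < F t) /\
                         (forall t, t0 - r < t < t0 -> F t < 0).
Proof.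
move=> [dF Fd] F0 d0.
have : \forall h \near (0 : R)^', 0 < h^-1 *: (F (h *: 1 + t0) - F t0).
  by apply: (cvgr_gt ('D_1 F t0)); [exact: dF|rewrite Fd].
move=> /nbhs_ballP[r /= r0 H]; exists r => //.
have {}H h : `|h| < r -> h != 0 -> 0 < h^-1 * F (h + t0).
  move=> hr h0; have := H h; rewrite /ball/= sub0r normrN => /(_ hr h0).
  by rewrite F0 subr0 /GRing.scale/= mulr1.
split=> t /andP[t1 t2].
  have t_gt : 0 < t - t0 by rewrite subr_gt0.
  have : 0 < (t - t0)^-1 * F (t - t0 + t0).
    by apply: H; [rewrite gtr0_norm//; lra|rewrite gt_eqF].
  by rewrite subrK pmulr_rgt0// invr_gt0.
have t_lt : t - t0 < 0 by rewrite subr_lt0.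
have : 0 < (t - t0)^-1 * F (t - t0 + t0).
  by apply: H; [rewrite ltr0_norm//; lra|rewrite lt_eqF].
by rewrite subrK nmulr_rgt0// invr_lt0.
Qed.

Variables F f : R -> R.
Hypothesis dF : forall t : R, lo < t < hi -> is_derive t 1 F (f t).
Hypothesis Fr : regular_on F f.

Let A := [set t | lo < t < hi /\ 0 < F t].

Lemma derive_continuous_at (t : R) : lo < t < hi -> {for t, continuous F}.
Proof.
move=> /dF[Ft _]; apply: differentiable_continuous.
exact/derivable1_diffP.
Qed.

Lemma open_pos_set : open A.
Proof.
rewrite openE => t [/andP[lt th] Ft]; rewrite /interior.
have cF : {for t, continuous F} by apply: derive_continuous_at; rewrite lt th.
have : \forall s \near t, 0 < F s by exact: cvgr_gt cF _ Ft.
have tD : t \in `]lo, hi[ by rewrite in_itv/= lt th.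
by move: (near_in_itvoo tD); apply: filterS2 => s; rewrite in_itv.
Qed.

Lemma pos_component x : A x -> exists a b,
  [/\ a < x < b, (lo <= a) && (b <= hi),
      connected_component A x = [set` `]a, b[], ~ A a & ~ A b].
Proof.
move=> Ax; have [|a [b [axb CE Aa Ab]]] :=
  @bounded_open_component _ A lo hi x open_pos_set _ Ax.
  by move=> t [ltt _]; rewrite /= in_itv.
have CA : [set` `]a, b[] `<=` A by rewrite -CE; exact: connected_component_sub.
have /andP[ax xb] := axb.
have inD t : a < t < b -> lo < t < hi.
  by move=> tab; have [] : A t by apply: CA; rewrite /= in_itv.
exists a, b; split => //; apply/andP; split.
  rewrite leNgt; apply/negP => alo; have := inD ((a + Num.min x lo) / 2).
  by case: (lerP x lo) => h H; have := H ltac:(lra); lra.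
rewrite leNgt; apply/negP => bhi; have := inD ((b + Num.max x hi) / 2).
by case: (lerP x hi) => h H; have := H ltac:(lra); lra.
Qed.

Lemma component_itvP a b : component_itv A a b ->
  [/\ a < b, (lo <= a) && (b <= hi), (forall t, a < t < b -> A t), ~ A a & ~ A b].
Proof.
move=> [x Ax CE]; have [a' [b' [/andP[a'x xb'] lab' CE' Aa' Ab']]] := pos_component Ax.
have [<- <-] : a' = a /\ b' = b.
  by apply: itvoo_inj; [exact: lt_trans xb'|rewrite -CE' CE].
split => //; first exact: lt_trans xb'.
move=> t tab; apply: (@connected_component_sub _ _ x).
by rewrite CE' /= in_itv.
Qed.

(** By continuity: F is positive arbitrarily close to an endpoint, and not
    positive at it. *)
Lemma component_endpoint_root a b t : component_itv A a b ->
  t = a \/ t = b -> lo < t < hi -> F t = 0.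
Proof.
move=> /component_itvP[ab /andP[la bh] abA Aa Ab] tab tD.
have Ft : F t <= 0.
  rewrite leNgt; apply/negP => Ft0.
  by case: tab => tE; [apply: Aa|apply: Ab]; split; rewrite -tE.
apply/eqP; rewrite eq_le Ft/= leNgt; apply/negP => {}Ft.
have cF := derive_continuous_at tD.
have : \forall s \near t, F s < 0 by exact: cvgr_lt cF _ Ft.
move=> /nbhs_ballP[e /= e0 H].
have {}H s : `|t - s| < e -> F s < 0 by exact: H.
case: tab => tE.
  have [] := abA (Num.min ((a + b) / 2) (a + e / 2)); first by
    case: (lerP ((a + b) / 2) (a + e / 2)) => h; lra.
  have : F (Num.min ((a + b) / 2) (a + e / 2)) < 0; last by lra.
  apply: H; rewrite tE ltr_norml.
  by case: (lerP ((a + b) / 2) (a + e / 2)) => h; lra.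
have [] := abA (Num.max ((a + b) / 2) (b - e / 2)); first by
  case: (lerP ((a + b) / 2) (b - e / 2)) => h; lra.
have : F (Num.max ((a + b) / 2) (b - e / 2)) < 0; last by lra.
apply: H; rewrite tE ltr_norml.
by case: (lerP ((a + b) / 2) (b - e / 2)) => h; lra.
Qed.

(** A one-sided neighbourhood of t0 inside A lies in one component of A, and that
    component stops at t0, which is not in A. The point c is on either side. *)
Lemma component_through c t0 : lo < t0 < hi -> F t0 = 0 ->
  (forall t, Num.min c t0 < t < Num.max c t0 -> A t) -> c != t0 ->
  exists a b, component_itv A a b /\ (t0 = a \/ t0 = b).
Proof.
move=> t0D Ft0 cA ct0.
have nA : ~ A t0 by move=> []; rewrite Ft0 ltxx.
pose x := (c + t0) / 2.
have xct : Num.min c t0 < x < Num.max c t0.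
  by rewrite /x; case: (ltgtP c t0) ct0 => // h _; lra.
have [a [b [axb _ CE Aa Ab]]] := pos_component (cA _ xct).
exists a, b; split; first by exists x => //; exact: cA.
have IC t : Num.min c t0 < t < Num.max c t0 -> a < t < b.
  move=> tct.
  have : connected_component A x t.
    apply: (@connected_component_max _ _ [set` `]Num.min c t0, Num.max c t0[]).
    - by rewrite /= in_itv.
    - by move=> s; rewrite /= in_itv => /cA.
    - by apply/connected_intervalP/interval_is_interval.
    - by rewrite /= in_itv.
  by rewrite CE /= in_itv.
have nt0 : ~ (a < t0 < b).
  move=> h; apply: nA; apply: (@connected_component_sub _ _ x).
  by rewrite CE /= in_itv.
move: xct IC; rewrite /x; case: (ltgtP c t0) ct0 => // h _ xct IC.
  right; apply/eqP; rewrite eq_le; apply/andP; split.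
    rewrite leNgt; apply/negP => tb; have := IC ((t0 + Num.max b ((c + t0) / 2)) / 2).
    by rewrite /x in axb; case: (lerP b ((c + t0) / 2)) => h' H; have := H ltac:(lra); lra.
  rewrite leNgt; apply/negP => tb; apply: nt0.
  rewrite /x in axb; lra.
left; apply/eqP; rewrite eq_le; apply/andP; split.
  rewrite leNgt; apply/negP => tb; apply: nt0.
  rewrite /x in axb; lra.
rewrite leNgt; apply/negP => tb; have := IC ((t0 + Num.min a ((c + t0) / 2)) / 2).
by rewrite /x in axb; case: (lerP a ((c + t0) / 2)) => h' H; have := H ltac:(lra); lra.
Qed.

Lemma regular_deriv_neq0 (t : R) : lo < t < hi -> F t = 0 -> f t != 0.
Proof.
have [e e0 H] := Fr; move=> /H + Ft0; rewrite Ft0 normr0 add0r => ef.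
by rewrite -normr_gt0; exact: lt_le_trans ef.
Qed.

Lemma regular_sign_change (t : R) : lo < t < hi -> F t = 0 ->
  exists2 r : R, 0 < r &
    ((forall s, t < s < t + r -> 0 < F s) /\ (forall s, t - r < s < t -> F s < 0))
    \/ ((forall s, t < s < t + r -> F s < 0) /\ (forall s, t - r < s < t -> 0 < F s)).
Proof.
move=> tD Ft0; have := regular_deriv_neq0 tD Ft0; have dFt := dF tD.
rewrite neq_lt => /orP[ft0|ft0]; last first.
  by have [r r0 rP] := pos_deriv_sign dFt Ft0 ft0; exists r => //; left.
have [||r r0 [rP1 rP2]] := @pos_deriv_sign (- F) t (- f t) (is_deriveN dFt).
- by rewrite fctE Ft0 oppr0.
- by rewrite oppr_gt0.
exists r => //; right; split => s.
  by move=> /rP1; rewrite fctE oppr_gt0.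
by move=> /rP2; rewrite fctE oppr_lt0.
Qed.

Lemma roots_eq_endpoints : [set t | lo < t < hi /\ F t = 0] =
  [set t | lo < t < hi /\ exists a b, component_itv A a b /\ (t = a \/ t = b)].
Proof.
apply/seteqP; split=> t [tD]; last first.
  by move=> [a [b [cab tab]]]; split => //; exact: component_endpoint_root tab tD.
move=> Ft0; split => //; have [r r0 rP] := regular_sign_change tD Ft0.
have /andP[lt th] := tD.
case: rP => -[P1 P2].
  have [c [tc cr ch]] : exists c, [/\ t < c, c <= t + r & c <= hi].
    exists (Num.min (t + r) hi); case: (lerP (t + r) hi) => h; split; lra.
  apply: (@component_through c) => //; last by rewrite gt_eqF.
  move=> s; rewrite (min_r (ltW tc)) (max_l (ltW tc)) => /andP[s1 s2].
  by split; [lra|apply: P1; lra].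
have [c [tc cr ch]] : exists c, [/\ c < t, t - r <= c & lo <= c].
  exists (Num.max (t - r) lo); case: (lerP (t - r) lo) => h; split; lra.
apply: (@component_through c) => //; last by rewrite lt_eqF.
move=> s; rewrite (min_l (ltW tc)) (max_r (ltW tc)) => /andP[s1 s2].
by split; [lra|apply: P2; lra].
Qed.

(** Two intervals meeting at a zero would make it a local minimum of F, hence
    a critical point. *)
Lemma regular_distinct_endpoints : distinct_endpoints A.
Proof.
have meet a b c : component_itv A a b -> component_itv A b c -> False.
  move=> cab cbc; have [ab /andP[la bh] abA Aa Ab] := component_itvP cab.
  have [bc /andP[lb ch] bcA _ Ac] := component_itvP cbc.
  have bD : lo < b < hi by lra.
  have Fb : F b = 0 by apply: (component_endpoint_root cab) => //; right.
  have [r r0 rP] := regular_sign_change bD Fb.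
  case: rP => -[P1 P2].
    have [s [as_ rs sb]] : exists s, [/\ a < s, b - r < s & s < b].
      exists (Num.max ((a + b) / 2) (b - r / 2)).
      by case: (lerP ((a + b) / 2) (b - r / 2)) => h; split; lra.
    have [] := abA s; first lra.
    by have := P2 s ltac:(lra); lra.
  have [s [bs sr sc]] : exists s, [/\ b < s, s < b + r & s < c].
    exists (Num.min ((b + c) / 2) (b + r / 2)).
    by case: (lerP ((b + c) / 2) (b + r / 2)) => h; split; lra.
  have [] := bcA s; first lra.
  by have := P1 s ltac:(lra); lra.
have same a b a' b' t : component_itv A a b -> component_itv A a' b' ->
    a < t < b -> a' < t < b' -> (a, b) = (a', b').
  move=> [x Ax xE] [x' Ax' xE'] tab tab'.
  have xt : connected_component A x t by rewrite xE /= in_itv.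
  have xt' : connected_component A x' t by rewrite xE' /= in_itv.
  have [||-> ->//] := @itvoo_inj R a b a' b'; first by lra.
  by rewrite -xE (same_connected_component xt) -(same_connected_component xt').
move=> a b a' b' c1 c2 ne.
have [ab _ _ _ _] := component_itvP c1; have [ab' _ _ _ _] := component_itvP c2.
split=> E.
- apply: ne; apply: (same _ _ _ _ (a + Num.min (b - a) (b' - a) / 2)) c1 c2 _ _;
  case: (lerP (b - a) (b' - a)) => h; lra.
- by apply: (meet a' b' b) => //; rewrite -E.
- by apply: (meet a b b') => //; rewrite E.
- apply: ne; apply: (same _ _ _ _ (b - Num.min (b - a) (b - a') / 2)) c1 c2 _ _;
  case: (lerP (b - a) (b - a')) => h; lra.
Qed.

(** Two zeros of F enclose a zero of f, while |f| >= e at the zeros of F; so a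
    Lipschitz bound on f keeps the zeros of F uniformly apart. *)
Lemma regular_roots_apart M : 0 < M ->
  (forall s t, lo < s < hi -> lo < t < hi -> `|f s - f t| <= M * `|s - t|) ->
  exists2 e : R, 0 < e & forall s t, lo < s < hi -> lo < t < hi ->
    F s = 0 -> F t = 0 -> s < t -> e <= t - s.
Proof.
move=> M0 fM; have [e e0 H] := Fr; exists (e / M); first exact: divr_gt0.
move=> s t sD tD Fs Ft st.
have [||c] := @MVT R F f s t st.
- by move=> x; rewrite in_itv/= => xst; apply: dF; lra.
- apply: continuous_in_subspaceT => x; rewrite inE/= in_itv/= => xst.
  by apply: derive_continuous_at; lra.
rewrite in_itv/= => cst; rewrite Fs Ft subrr => /esym/eqP.
rewrite mulf_eq0 subr_eq0 (gt_eqF st) orbF => /eqP fc.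
have := H s sD; rewrite Fs normr0 add0r => efs.
have := fM s c sD ltac:(lra); have cs : 0 < c - s by lra.
rewrite fc subr0 distrC (gtr0_norm cs).
move=> fsM; rewrite ler_pdivrMr//; apply: (le_trans efs).
by apply: (le_trans fsM); rewrite mulrC ler_pM2r//; lra.
Qed.

End regular_functions.

(** * Grids and counting *)

Section grid.
Context {R : realType}.
Implicit Types (a b s t : R) (N q : nat).

Definition step a b N : R := (b - a) / N%:R.
Definition node a b N q : R := a + q%:R * step a b N.
Definition mid a b N q : R := a + (q%:R + 2^-1) * step a b N.
Definition cell a b N t : nat := Num.truncn ((t - a) / step a b N).

Variables (a b : R) (N : nat).
Hypotheses (ab : a < b) (N0 : (0 < N)%N).

Lemma step_gt0 : 0 < step a b N.
Proof. by rewrite /step divr_gt0 ?subr_gt0 ?ltr0n. Qed.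

Lemma step_mulN : N%:R * step a b N = b - a.
Proof. by rewrite /step mulrC divfK// pnatr_eq0 -lt0n. Qed.

Lemma cell_itv t : a <= t -> node a b N (cell a b N t) <= t < node a b N (cell a b N t).+1.
Proof.
move=> at_; have h0 := step_gt0.
have : 0 <= (t - a) / step a b N by rewrite divr_ge0 ?subr_ge0// ltW.
move=> /truncn_itv; rewrite -/(cell a b N t) ler_pdivlMr// ltr_pdivrMr// /node.
by lra.
Qed.

Lemma cell_lt t : a <= t < b -> (cell a b N t < N)%N.
Proof.
move=> /andP[at_ tb]; have h0 := step_gt0.
rewrite /cell truncn_lt_nat; last by rewrite divr_ge0 ?subr_ge0// ltW.
by rewrite ltr_pdivrMr// step_mulN ltrD2r.
Qed.

Lemma cell_mid t : a <= t -> `|t - mid a b N (cell a b N t)| <= step a b N / 2.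
Proof.
move=> /cell_itv; rewrite /node /mid ler_norml -natr1.
move: (step _ _ _) (_%:R) => h q; rewrite !mulrDl mul1r => /andP[h1 h2].
by apply/andP; split; lra.
Qed.

Lemma cell_eq_dist s t : a <= s -> a <= t -> cell a b N s = cell a b N t ->
  `|s - t| < step a b N.
Proof.
move=> /cell_itv + /cell_itv + st; rewrite st /node -natr1 ltr_norml.
move: (step _ _ _) (_%:R) => h q; rewrite !mulrDl mul1r.
by move=> /andP[h1 h2] /andP[h3 h4]; apply/andP; split; lra.
Qed.

Lemma mid_itv q : (q < N)%N -> a < mid a b N q < b.
Proof.
move=> qN; rewrite /mid; have h0 := step_gt0; have hN := step_mulN.
have qN' : q%:R + 1 <= N%:R :> R by rewrite natr1 ler_nat.
have q0 : 0 <= q%:R :> R by [].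
apply/andP; split; first by rewrite ltrDl mulr_gt0//; lra.
rewrite -ltrBrDl -hN ltr_pM2r//; lra.
Qed.

End grid.

Section counting.
Context {R : realType}.

Lemma count_le_slots (T : eqType) (s : seq T) (P : pred T) N (Q : pred 'I_N)
    (f : T -> nat) (fN : forall x, x \in s -> P x -> (f x < N)%N) : uniq s ->
  (forall x (xs : x \in s) (Px : P x), Q (Ordinal (fN x xs Px))) ->
  (forall x y, x \in s -> y \in s -> P x -> P y -> f x = f y -> x = y) ->
  (\sum_(x <- s | P x) 1 <= \sum_(q < N | Q q) 1 :> R).
Proof.
move=> us PQ finj; have count1 (I : Type) (r : seq I) (A : pred I) :
  \sum_(i <- r | A i) (1 : R) = (count A r)%:R by rewrite -sum1_count natr_sum.
rewrite !count1 ler_nat -!size_filter -(size_map val) -(size_map f).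
apply: uniq_leq_size.
  rewrite map_inj_in_uniq ?filter_uniq// => x y.
  by rewrite !mem_filter => /andP[Px xs] /andP[Py ys]; exact: finj.
move=> _ /mapP[x + ->]; rewrite mem_filter => /andP[Px xs].
apply/mapP; exists (Ordinal (fN x xs Px)) => //.
by rewrite mem_filter PQ mem_index_enum.
Qed.

(** If two entries at distance at least two force the smaller one to be at most
    M times that distance, the bounds telescope along the marked indices, and
    only the last two entries need the uniform bound. *)
Lemma sum_sparse_le (P : pred nat) (f : nat -> R) (B M : R) K :
  0 <= B -> 0 <= M -> (forall i, (i < K)%N -> P i -> f i <= B) ->
  (forall i j, P i -> P j -> (i + 2 <= j)%N -> (j < K)%N ->
     f i <= M * (j%:R - i%:R)) ->
  \sum_(i < K | P i) f i <= 2 * B + 2 * M * K%:R.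
Proof.
move=> B0 M0 fB fM.
rewrite -(big_mkord P f) -big_filter.
have : sorted ltn [seq i <- index_iota 0 K | P i].
  by apply: (sorted_filter ltn_trans); exact: iota_ltn_sorted.
have : all (fun i => P i && (i < K)%N) [seq i <- index_iota 0 K | P i].
  by apply/allP => i; rewrite mem_filter mem_index_iota => /and3P[-> _ ->].
move: [seq _ <- _ | _] => s.
have M2K i : (i < K)%N -> 0 <= M * (K%:R - i%:R).
  by move=> iK; rewrite mulr_ge0// subr_ge0 ler_nat ltnW.
suff H i j s' : all (fun i => P i && (i < K)%N) [:: i, j & s'] ->
    sorted ltn [:: i, j & s'] ->
    \sum_(x <- [:: i, j & s']) f x <=
      2 * B + M * (K%:R - i%:R) + M * (K%:R - j%:R).
  have KM : 0 <= M * K%:R by rewrite mulr_ge0.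
  case: s => [|i [|j s]] sP ss.
  - by rewrite big_nil; nra.
  - rewrite big_seq1; move: sP => /= /andP[/andP[Pi iK] _].
    by have := fB i iK Pi; nra.
  - apply: (le_trans (H _ _ _ sP ss)).
    have : 0 <= M * i%:R by rewrite mulr_ge0.
    have : 0 <= M * j%:R by rewrite mulr_ge0.
    lra.
elim: s' i j => [|m s' IH] i j.
  move=> /= /and3P[/andP[Pi iK] /andP[Pj jK] _] _.
  rewrite big_cons big_seq1.
  by have := fB i iK Pi; have := fB j jK Pj; have := M2K i iK; have := M2K j jK; lra.
move=> /= /andP[/andP[Pi iK] H] /andP[ij ss]; rewrite big_cons.
have /andP[Pm mK] : P m && (m < K)%N by move: H => /and3P[].
have jm : (j < m)%N by move: ss => /andP[].
have im : (i + 2 <= m)%N by rewrite addn2; exact: leq_trans jm.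
have := fM i m Pi Pm im mK; have := IH _ _ H ss.
by move: (\sum_(_ <- _) _) => S; lra.
Qed.

End counting.

(** * Gaps of finite sets and their dyadic layers *)

Section mdelta.
Context {R : realType}.
Implicit Types (X : set R) (rho delta : R).

Lemma seq_argmin (T : eqType) (f : T -> R) (y0 : T) (s : seq T) :
  exists2 y, y \in y0 :: s & forall z, z \in y0 :: s -> f y <= f z.
Proof.
elim: s y0 => [|y1 s IH] y0.
  by exists y0; rewrite ?mem_head// => z; rewrite inE => /eqP ->.
have [y ys ymin] := IH y1; have [h|h] := lerP (f y0) (f y).
  exists y0; rewrite ?mem_head// => z; rewrite inE => /predU1P[->//|/ymin].
  exact: le_trans.
exists y; first by rewrite inE ys orbT.
by move=> z; rewrite inE => /predU1P[->|/ymin//]; exact: ltW.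
Qed.

Lemma gapP rho X x : finite_set X -> X `\ x !=set0 ->
  exists2 y, (X `\ x) y & gap rho X x = `|x - y| /\
    forall z, X z -> z != x -> gap rho X x <= `|x - z|.
Proof.
move=> finX /[dup] /set0P Xx0 [y0 Xy0]; rewrite /gap (negbTE Xx0).
have /finite_seqP[s sE] : finite_set (X `\ x) by exact: finite_setD.
have [y ys ymin] := seq_argmin (fun y => `|x - y|) y0 s.
have Xs z : z \in y0 :: s <-> (X `\ x) z.
  rewrite inE sE /=; split => [/predU1P[->|//]|->]; last by rewrite orbT.
  by move: Xy0; rewrite sE.
have Xy : (X `\ x) y by exact/Xs.
suff -> : inf [set `|x - eta| | eta in X `\ x] = `|x - y|.
  exists y => //; split => // z Xz /eqP zx.
  by apply: ymin; apply/Xs.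
apply/eqP; rewrite eq_le; apply/andP; split.
  apply: ge_inf; last by exists y.
  by exists 0 => _ [z _ <-].
apply: lb_le_inf; first by exists `|x - y|; exists y.
by move=> _ [z /Xs zs <-]; exact: ymin.
Qed.

Lemma gap_set1 rho X x : X `\ x = set0 -> gap rho X x = 4 * rho.
Proof. by move=> X0; rewrite /gap X0 eqxx. Qed.

Lemma mdelta_finite rho delta X : finite_set X -> X !=set0 ->
  mdelta rho delta X = \sum_(x <- fset_set X) gap rho X x `^ (- delta).
Proof. by move=> finX /set0P/negbTE X0; rewrite /mdelta X0 fsbig_finite. Qed.

Lemma powRN_le delta (x y : R) : 0 <= delta -> 0 < x -> x <= y ->
  y `^ (- delta) <= x `^ (- delta).
Proof.
move=> d0 x0 xy; rewrite !powRN lef_pV2 ?posrE ?powR_gt0//.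
  by rewrite ge0_ler_powR// nnegrE ltW//; exact: lt_le_trans xy.
exact: lt_le_trans xy.
Qed.

Lemma powRN_halves delta (w : R) k : 0 < w ->
  (w / 2 ^+ k) `^ (- delta) = w `^ (- delta) * (2 `^ delta) ^+ k.
Proof.
move=> w0; elim: k => [|k IH]; first by rewrite !expr0 divr1 mulr1.
rewrite !exprSr mulrA -IH invfM mulrA powRM ?divr_ge0 ?exprn_ge0 ?ltW//.
by congr (_ * _); rewrite -powR_inv1// -powRrM mulN1r opprK.
Qed.

(** The term with w / 2 ^+ k.+1 < g <= w / 2 ^+ k alone exceeds the left-hand
    side. *)
Lemma powRN_layers delta (w g : R) K : 0 <= delta -> 0 < g <= w -> w / 2 ^+ K < g ->
  g `^ (- delta) <= w `^ (- delta) *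
    \sum_(k < K) (2 `^ delta) ^+ k.+1 * (g <= w / 2 ^+ k)%R%:R.
Proof.
move=> d0 /andP[g0 gw] wK; have w0 : 0 < w by exact: lt_le_trans gw.
have ex : exists k, w / 2 ^+ k < g by exists K.
pose m := ex_minn ex; have [mg mmin] : w / 2 ^+ m < g /\ forall n, w / 2 ^+ n < g -> (m <= n)%N.
  by rewrite /m; case: ex_minnP.
have mK : (m <= K)%N by exact: mmin.
case E : m => [|k]; first by move: mg; rewrite E expr0 divr1 ltNge gw.
have kK : (k < K)%N by rewrite -E.
have gk : g <= w / 2 ^+ k.
  by rewrite leNgt; apply/negP => /mmin; rewrite E ltnn.
apply: (@le_trans _ _ ((w / 2 ^+ k.+1) `^ (- delta))).
  by apply: powRN_le => //; [rewrite divr_gt0// exprn_gt0|rewrite -E ltW].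
rewrite powRN_halves//.  rewrite ler_pM2l ?powR_gt0//. 
rewrite (bigD1 (Ordinal kK))//= gk mulr1 lerDl. apply: sumr_ge0 => i _.
by rewrite mulr_ge0// exprn_ge0// powR_ge0.
Qed.

Definition crowded X (r x : R) := `[< exists2 y, X y & y != x /\ `|x - y| <= r >].

(** If X has several points, each of them is crowded at scale r as soon as its gap
    is at most r. The summand 1 accounts for the sets with at most one point. *)
Lemma mdelta_layers rho delta X K : 0 < rho -> 0 <= delta -> finite_set X ->
  (forall x, X x -> - (2 * rho) < x < 2 * rho) ->
  (forall x y, X x -> X y -> x != y -> 4 * rho / 2 ^+ K < `|x - y|) ->
  mdelta rho delta X <= (4 * rho) `^ (- delta) *
    (1 + \sum_(k < K) (2 `^ delta) ^+ k.+1 *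
           \sum_(x <- fset_set X | crowded X (4 * rho / 2 ^+ k) x) 1).
Proof.
move=> rho0 d0 finX XD sep; set w := 4 * rho.
have w0 : 0 < w by rewrite mulr_gt0.
have S0 : 0 <= \sum_(k < K) (2 `^ delta) ^+ k.+1 *
           \sum_(x <- fset_set X | crowded X (w / 2 ^+ k) x) (1 : R).
  by apply: sumr_ge0 => k _; rewrite mulr_ge0 ?exprn_ge0 ?powR_ge0// sumr_ge0.
have [X0|/set0P X0] := eqVneq X set0.
  by rewrite /mdelta X0 eqxx -/w -X0 ler_peMr ?powR_ge0// lerDl.
rewrite mdelta_finite//.
have [[x [Xx Xx0]]|nsing] := pselect (exists x, X x /\ X `\ x = set0).
  have -> : X = [set x].
    apply/seteqP; split=> [y Xy|y ->//]; apply: contrapT => yx.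
    by have : (X `\ x) y by []; rewrite Xx0.
  rewrite fset_set1 big_seq_fset1 gap_set1 ?setDv//.
  rewrite ler_peMr ?powR_ge0// lerDl sumr_ge0// => k _.
  by rewrite mulr_ge0 ?exprn_ge0 ?powR_ge0// sumr_ge0.
apply: (@le_trans _ _ (w `^ (- delta) * \sum_(k < K) (2 `^ delta) ^+ k.+1 *
           \sum_(x <- fset_set X | crowded X (w / 2 ^+ k) x) 1)); last first.
  by rewrite ler_pM2l ?powR_gt0// lerDr.
under [X in _ <= _ * X]eq_bigr => k _ do rewrite big_mkcond mulr_sumr.
rewrite exchange_big mulr_sumr [leRHS]big_seq [leLHS]big_seq /=.
apply: ler_sum => x; rewrite in_fset_set// inE => Xx.
have Xx1 : X `\ x !=set0.
  by apply/set0P/eqP => E; apply: nsing; exists x.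
have [y [Xy yx] [gE gmin]] := gapP rho finX Xx1.
have xy : y != x by apply/eqP.
apply: le_trans (@powRN_layers delta w (gap rho X x) K d0 _ _) _.
- rewrite gE normr_gt0 subr_eq0 eq_sym xy/= ler_norml.
  by have := XD _ Xx; have := XD _ Xy; rewrite /w => h1 h2; lra.
- by rewrite gE; apply: sep => //; rewrite eq_sym.
rewrite ler_pM2l ?powR_gt0//; apply: ler_sum => k _.
rewrite ler_pM2l ?exprn_gt0 ?powR_gt0//.
case: ifPn => [_|/asboolPn nc]; first by rewrite lern1 leq_b1.
case: (lerP (gap rho X x)) => // h; exfalso; apply: nc; exists y => //.
by split => //; rewrite -gE.
Qed.

End mdelta.

(** * Continuity of the gap functional *)

Section rounding.
Context {R : realType}.
Implicit Types (X : set R) (rho delta : R).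

Lemma gap_gt0 rho X x : 0 < rho -> finite_set X -> 0 < gap rho X x.
Proof.
move=> rho0 finX; have [X0|/set0P X0] := eqVneq (X `\ x) set0.
  by rewrite gap_set1// mulr_gt0.
have [y [_ yx] [-> _]] := gapP rho finX X0.
by rewrite normr_gt0 subr_eq0; apply/eqP => xy; apply: yx.
Qed.

(** Distances between points change by at most 2 * e, and the gap of a finite
    set is attained. *)
Lemma gap_image rho X (r : R -> R) e x : finite_set X -> X x ->
  {in X &, injective r} -> (forall y, X y -> `|r y - y| <= e) ->
  `|gap rho (r @` X) (r x) - gap rho X x| <= 2 * e.
Proof.
move=> finX Xx rinj re.
have e0 : 0 <= e by apply: le_trans (re _ Xx).
have inX y : X y -> y \in X by move=> Xy; rewrite inE.
have [X0|/set0P X0] := eqVneq (X `\ x) set0.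
  rewrite !gap_set1 ?subrr ?normr0 ?mulr_ge0//.
  rewrite -subset0 => _ [[y Xy <-] /= ryx].
  have : (X `\ x) y by split => //= yx; apply: ryx; rewrite yx.
  by rewrite X0.
have [y [Xy yx] [gE gmin]] := gapP rho finX X0.
have rX0 : (r @` X) `\ r x !=set0.
  exists (r y); split; first by exists y.
  by move=> /= /rinj E; apply: yx; apply: E; exact: inX.
have [y' [[z Xz <-] zx] [rE rmin]] := gapP rho (finite_image r finX) rX0.
have rdist u v : X u -> X v -> `| `|r u - r v| - `|u - v| | <= 2 * e.
  move=> Xu Xv; apply: (le_trans (ler_dist_dist _ _)).
  rewrite (_ : _ - _ = (r u - u) - (r v - v)); last by ring.
  by apply: (le_trans (ler_normB _ _)); have := re u Xu; have := re v Xv; lra.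
have zx' : z != x by apply/eqP => E; apply: zx; rewrite E.
have ryx : r y != r x by apply/eqP => /rinj E; apply: yx; apply: E; exact: inX.
have := gmin z Xz zx'; have := rmin (r y) (ex_intro2 _ _ y Xy erefl) ryx.
have := rdist x y Xx Xy; have := rdist x z Xx Xz.
rewrite gE rE.
move: `|x - y| `|x - z| `|r x - r y| `|r x - r z| => a b c d.
by rewrite !ler_norml => h1 h2 h3 h4; lra.
Qed.

Lemma powRN_cvg (u : nat -> R) (l a : R) : 0 < l ->
  u @ \oo --> l -> (fun n => u n `^ a) @ \oo --> l `^ a.
Proof.
move=> l0 ul.
have -> : l `^ a = expR (a * ln l) by rewrite /powR gt_eqF.
have cv : (fun n => expR (a * ln (u n))) @ \oo --> expR (a * ln l).
  apply: (continuous_cvg _ (@continuous_expR R _)).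
  apply: cvgMr; apply: (continuous_cvg _ (continuous_ln l0)); exact: ul.
apply: cvg_trans cv; apply: near_eq_cvg.
have : \forall n \near \oo, 0 < u n by exact: cvgr_gt ul _ l0.
by apply: filterS => n un; rewrite /powR gt_eqF.
Qed.

Lemma cvg_seq_sum (I : Type) (s : seq I) (u : I -> nat -> R) (l : I -> R) :
  (forall i, u i @ \oo --> l i) ->
  (fun n => \sum_(i <- s) u i n) @ \oo --> \sum_(i <- s) l i.
Proof.
move=> ul; elim: s => [|i s IH].
  by rewrite big_nil; under eq_fun do rewrite big_nil; exact: cvg_cst.
by rewrite big_cons; under eq_fun do rewrite big_cons; exact: cvgD.
Qed.

(** There are finitely many gaps, all positive, and each of them converges; the
    maps r p need only be injective on X eventually. *)
Lemma mdelta_round_cvg rho delta X (r : nat -> R -> R) (e : nat -> R) :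
  0 < rho -> finite_set X -> e @ \oo --> 0 ->
  (forall p x, X x -> `|r p x - x| <= e p) ->
  (fun p => mdelta rho delta (r p @` X)) @ \oo --> mdelta rho delta X.
Proof.
move=> rho0 finX e0 re.
have [X0|/set0P X0] := eqVneq X set0.
  by rewrite X0; under eq_fun do rewrite image_set0; exact: cvg_cst.
(* the smallest gap bounds all mutual distances from below *)
have [s0 s00 sep] : exists2 s0 : R, 0 < s0 & forall x y, X x -> X y -> x != y -> s0 <= `|x - y|.
  have [z [z0 zX]] : exists z : R, 0 < z /\ forall x, x \in (fset_set X : seq R) -> z <= gap rho X x.
    elim: (fset_set X : seq R) => [|y s [z [z0 zs]]]; first by exists 1.
    exists (Num.min z (gap rho X y)); split; first by rewrite lt_min z0 gap_gt0.
    move=> x; rewrite inE ge_min => /predU1P[->|/zs ->//].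
    by rewrite lexx orbT.
  exists z => // x y Xx Xy xy.
  have xs : x \in (fset_set X : seq R) by rewrite in_fset_set// inE.
  apply: (le_trans (zX _ xs)).
  have yX : (X `\ x) y by split => //= E; rewrite E eqxx in xy.
  have [_ _ [_ gmin]] := gapP rho finX (ex_intro _ y yX).
  by apply: gmin => //; rewrite eq_sym.
have inj : \forall p \near \oo, {in X &, injective (r p)}.
  have : \forall p \near \oo, e p < s0 / 2.
    by apply: (cvgr_lt _ e0); rewrite divr_gt0.
  apply: filterS => p ep x y /set_mem Xx /set_mem Xy E.
  apply/eqP/negPn/negP => /(sep _ _ Xx Xy).
  have := re p x Xx; have := re p y Xy; rewrite E.
  have -> : x - y = (r p y - y) - (r p y - x) by ring.
  have := ler_normB (r p y - y) (r p y - x); lra.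
rewrite mdelta_finite//.
have cvs : (fun p => \sum_(x <- fset_set X) if x \in X then gap rho (r p @` X) (r p x) `^ (- delta) else 0) @ \oo
    --> \sum_(x <- fset_set X) if x \in X then gap rho X x `^ (- delta) else 0.
  apply: cvg_seq_sum => x; case: ifPn => [/set_mem Xx|_]; last exact: cvg_cst.
  apply: powRN_cvg; first exact: gap_gt0.
  apply/cvgrPdist_le => z z0.
  have : \forall p \near \oo, e p < z / 2.
    by apply: (cvgr_lt _ e0); rewrite divr_gt0.
  apply: filterS2 inj => p rinj ep; rewrite distrC.
  by apply: (le_trans (gap_image rho finX Xx rinj (re p))); lra.
have XE (F : R -> R) : \sum_(x <- fset_set X) (if x \in X then F x else 0) =
    \sum_(x <- fset_set X) F x.
  by rewrite !big_seq; apply: eq_bigr => x; rewrite in_fset_set// => ->.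
rewrite -XE; apply: cvg_trans cvs; apply: near_eq_cvg.
apply: filterS inj => p rinj; rewrite XE.
have [x0 Xx0] := X0.
rewrite mdelta_finite; [|exact: finite_image|by exists (r p x0); exists x0].
rewrite -fsbig_finite//.
rewrite -[RHS]fsbig_finite; last exact: finite_image.
by apply/esym; apply: reindex_fsbig; apply: inj_bij.
Qed.

End rounding.

(** * Upper bounds for integrals *)

Section integral_bounds.
Context {d} {T : measurableType d} {R : realType}.
Variable mu : {measure set T -> \bar R}.
Variables (D : set T) (mD : measurable D).
Implicit Types (g : T -> R) (B : R).

(** Packaged with measurability and sign so that upper bounds of integrals add up
    term by term. *)
Definition int_le g B := [/\ measurable_fun D g, forall x, D x -> 0 <= g x
  & (\int[mu]_(x in D) (g x)%:E <= B%:E)%E].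

Let mE g : measurable_fun D g -> measurable_fun D (fun x => (g x)%:E).
Proof. by move=> mg; exact/measurable_EFinP. Qed.

Lemma int_le_sum (I : Type) (s : seq I) (P : pred I) (g : I -> T -> R) (B : I -> R) :
  (forall i, P i -> int_le (g i) (B i)) ->
  int_le (fun x => \sum_(i <- s | P i) g i x) (\sum_(i <- s | P i) B i).
Proof.
move=> gB; elim: s => [|i s [IHm IH0 IHi]].
  rewrite big_nil; under eq_fun do rewrite big_nil; split=> //.
  by rewrite integral0_eq.
rewrite big_cons; under eq_fun do rewrite big_cons.
case: ifPn => [/gB[mg g0 gi]|_]; last by split.
split; first exact: measurable_funD.
- by move=> x Dx; rewrite addr_ge0 ?g0 ?IH0.
- under eq_integral do rewrite EFinD.
  rewrite EFinD ge0_integralD//; [exact: leeD|exact: mE|exact: mE].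
Qed.

Lemma int_le_scale k g B : 0 <= k -> int_le g B -> int_le (fun x => k * g x) (k * B).
Proof.
move=> k0 [mg g0 gi]; split; first exact: measurable_funM.
  by move=> x Dx; rewrite mulr_ge0 ?g0.
under eq_integral do rewrite EFinM.
rewrite ge0_integralZl_EFin//.
- by rewrite EFinM; apply: lee_wpmul2l => //; rewrite lee_fin.
- exact: mE.
Qed.

Lemma int_le_indic (A : set T) B : measurable A -> (mu A <= B%:E)%E ->
  int_le (\1_A) B.
Proof.
move=> mA AB; split; [exact: measurable_indic|by []|].
rewrite integral_indic//; apply: le_trans AB.
by apply: le_measure; rewrite ?inE//; exact: measurableI.
Qed.

Lemma int_le_one B : (mu D <= B%:E)%E -> int_le (fun=> 1) B.
Proof.
by move=> DB; split=> //; rewrite integral_cst// mul1e.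
Qed.

Lemma int_le_add g1 g2 B1 B2 : int_le g1 B1 -> int_le g2 B2 ->
  int_le (fun x => g1 x + g2 x) (B1 + B2).
Proof.
move=> [mg1 g10 gi1] [mg2 g20 gi2]; split; first exact: measurable_funD.
- by move=> x Dx; rewrite addr_ge0 ?g10 ?g20.
- under eq_integral do rewrite EFinD.
  rewrite EFinD ge0_integralD//; [exact: leeD|exact: mE|exact: mE].
Qed.

Lemma int_le_le g B B' : B <= B' -> int_le g B -> int_le g B'.
Proof. by move=> BB [mg g0 gi]; split=> //; apply: (le_trans gi); rewrite lee_fin. Qed.

(** Fatou's lemma, applied to the minimum of g and f n, which is eventually equal
    to g at each point. *)
Lemma int_le_fatou g (f : nat -> T -> R) B : measurable_fun D g ->
  (forall x, D x -> 0 <= g x) -> (forall n, int_le (f n) B) ->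
  (forall x, D x -> \forall n \near \oo, g x <= f n x) -> int_le g B.
Proof.
move=> mg g0 fB gf; split => //.
pose u n x := (Num.min (g x) (f n x))%:E.
have mu_ n : measurable_fun D (u n).
  by apply/measurable_EFinP/measurable_minr => //; have [] := fB n.
have u0 n x : D x -> (0 <= u n x)%E.
  by move=> Dx; rewrite lee_fin le_min g0//=; have [_ + _] := fB n; exact.
have uB n : (\int[mu]_(x in D) u n x <= B%:E)%E.
  have [mf f0 fi] := fB n; apply: le_trans fi; apply: ge0_le_integral => //.
  - exact: u0.
  - exact: mE.
  - by move=> x Dx; rewrite lee_fin ge_min lexx orbT.
apply: (@le_trans _ _ (\int[mu]_(x in D) limn_einf (u^~ x))%E).
  rewrite le_eqVlt; apply/orP; left; apply/eqP; apply: eq_integral => x /set_mem Dx.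
  have ux : u^~ x @ \oo --> (g x)%:E.
    apply: cvg_near_cst; apply: filterS (gf x Dx) => n gfn.
    by rewrite /u min_l.
  by have [-> _] := cvg_limn_einf_sup ux.
apply: (le_trans (fatou mu mD mu_ u0)).
rewrite limn_einf_lim; apply: lime_le; first exact: is_cvg_einfs.
apply: nearW => n; apply: le_trans (uB n).
by apply: ereal_inf_lbound; exists n => //=.
Qed.

End integral_bounds.

Section integral_nonmeasurable.
Context {d} {T : measurableType d} {R : realType}.
Variables (mu : {measure set T -> \bar R}) (D : set T).
Local Open Scope ereal_scope.

Import HBNNSimple.

(** Only the larger function is assumed measurable: the integral of the smaller
    one is a supremum over the simple functions below it, and these compare
    almost everywhere with f2. *)
Lemma ae_ge0_le_integral_sup (f1 f2 : T -> \bar R) : measurable D ->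
  (forall x, D x -> 0 <= f1 x) -> (forall x, D x -> 0 <= f2 x) ->
  measurable_fun D f2 -> {ae mu, forall x, D x -> f1 x <= f2 x} ->
  \int[mu]_(x in D) f1 x <= \int[mu]_(x in D) f2 x.
Proof.
move=> mD f10 f20 mf2 [N [mN N0 HN]].
rewrite (ge0_integralE mu f10); apply: ge_ereal_sup => _ [h hf <-].
have -> : sintegral mu h = \int[mu]_x (h x)%:E.
  by rewrite integral_nnsfun// patch_setT.
rewrite [leRHS]integral_mkcond.
apply: ae_ge0_le_integral => //.
- by move=> x _; rewrite lee_fin.
- by apply/measurable_EFinP.
- by move=> x _; apply: erestrict_ge0.
- exact/(measurable_restrictT _ mD).1.
exists N; split => // x /= nx; apply: HN => /= H; apply: nx => _.
apply: (le_trans (hf x)); rewrite !patchE; case: ifPn => // /set_mem Dx.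
exact: H.
Qed.

End integral_nonmeasurable.

(** * One level set of a function of one variable *)

Section lipschitz.
Context {R : realType}.

Lemma bounded_deriv_lipschitz (P : R -> Prop) (g g' : R -> R) (M : R) :
  (forall s t u, P s -> P t -> s <= u <= t -> P u) ->
  (forall t : R, P t -> is_derive t 1 g (g' t)) ->
  (forall t, P t -> `|g' t| <= M) ->
  forall s t, P s -> P t -> `|g s - g t| <= M * `|s - t|.
Proof.
move=> Pc dg gM s t; wlog : s t / s <= t.
  move=> H Ps Pt; have [st|ts] := orP (le_total s t); first exact: H.
  by rewrite distrC (distrC s); exact: H.
rewrite le_eqVlt => /predU1P[->|st] Ps Pt; first by rewrite !subrr !normr0 mulr0.
have cg x : P x -> {for x, continuous g}.
  by move=> /dg[dgx _]; exact/differentiable_continuous/derivable1_diffP.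
have [||x] := @MVT R g g' s t st.
- move=> x; rewrite in_itv/= => /andP[sx xt]; apply: dg; apply: (Pc s t) => //; lra.
- apply: continuous_in_subspaceT => x; rewrite inE/= in_itv/= => xst.
  by apply: cg; exact: (Pc s t).
rewrite in_itv/= => xst E; rewrite distrC E normrM (distrC s).
by apply: ler_wpM2r => //; apply: gM; apply: (Pc s t) => //; lra.
Qed.

Lemma rolle_root (P : R -> Prop) (g g' : R -> R) :
  (forall s t u, P s -> P t -> s <= u <= t -> P u) ->
  (forall t : R, P t -> is_derive t 1 g (g' t)) ->
  forall s t, P s -> P t -> s < t -> g s = g t -> exists2 z, s < z < t & g' z = 0.
Proof.
move=> Pc dg s t Ps Pt st gst.
have cg x : P x -> {for x, continuous g}.
  by move=> /dg[dgx _]; exact/differentiable_continuous/derivable1_diffP.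
have [||x] := @MVT R g g' s t st.
- move=> x; rewrite in_itv/= => /andP[sx xt]; apply: dg; apply: (Pc s t) => //; lra.
- apply: continuous_in_subspaceT => x; rewrite inE/= in_itv/= => xst.
  by apply: cg; exact: (Pc s t).
rewrite in_itv/= gst subrr => xst /esym/eqP.
by rewrite mulf_eq0 subr_eq0 (gt_eqF st) orbF => /eqP fx; exists x.
Qed.

End lipschitz.

Section one_dim.
Context {R : realType}.
Variables (rho M2 M3 : R) (f0 f1 f2 f3 : R -> R).
Hypothesis rho0 : 0 < rho.
Let lo : R := - (2 * rho).
Let hi : R := 2 * rho.
Let w : R := 4 * rho.
Let D (t : R) := lo < t < hi.
Hypothesis d1 : forall t : R, D t -> is_derive t 1 f0 (f1 t).
Hypothesis d2 : forall t : R, D t -> is_derive t 1 f1 (f2 t).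
Hypothesis d3 : forall t : R, D t -> is_derive t 1 f2 (f3 t).
Hypothesis b2 : forall t, D t -> `|f2 t| <= M2.
Hypothesis b3 : forall t, D t -> `|f3 t| <= M3.

Let lohi : lo < hi. Proof. by have := rho0; rewrite /lo /hi => ?; lra. Qed.
Let w0 : 0 < w. Proof. by have := rho0; rewrite /w => ?; lra. Qed.
Let D0 : D 0. Proof. by have := rho0; rewrite /D /lo /hi => ?; lra. Qed.
Let M20 : 0 <= M2. Proof. exact: le_trans (b2 D0). Qed.
Let M30 : 0 <= M3. Proof. exact: le_trans (b3 D0). Qed.
Let Dc s t u : D s -> D t -> s <= u <= t -> D u.
Proof. by rewrite /D => h1 h2 h3; lra. Qed.

Let h k : R := w / 2 ^+ k.
Let h0 k : 0 < h k. Proof. by rewrite divr_gt0// exprn_gt0. Qed.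
Let stepE k : step lo hi (2 ^ k) = h k.
Proof. by rewrite /step /h natrX; congr (_ / _); rewrite /hi /lo /w; ring. Qed.
Let hE k : (2 ^ k)%:R * h k = w.
Proof. by rewrite /h natrX mulrC divfK// expf_neq0. Qed.
Let N0 k : (0 < 2 ^ k)%N. Proof. by rewrite expn_gt0. Qed.

(** The windows have width 2 * h k, cut off at hi, and their left ends are h k
    apart, starting from lo: they overlap, so that any two points at distance at most h k share one. *)
Definition win_lo k i : R := node lo hi (2 ^ k) i.
Definition win_hi k i : R := Num.min (node lo hi (2 ^ k) i.+2) hi.
Definition critical k i := `[< exists2 z, win_lo k i < z < win_hi k i & f1 z = 0 >].
(** The second factor bounds |f2| on the window, from its value at one point of
    the window and the Lipschitz constant M3. *)
Definition slope k i : R := 2 * h k * (`|f2 (mid lo hi (2 ^ k) i)| + 2 * h k * M3).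

Let win_loE k i : win_lo k i = lo + i%:R * h k.
Proof. by rewrite /win_lo /node stepE. Qed.
Let win_hi_le k i : win_hi k i <= hi.
Proof. by rewrite /win_hi ge_min lexx orbT. Qed.
Let win_hi_lo k i : win_hi k i <= win_lo k i + 2 * h k.
Proof. by rewrite /win_hi ge_min win_loE /node stepE -(natr1 i.+1) -(natr1 i); apply/orP; left; lra. Qed.
Let win_lo_ge k i : lo <= win_lo k i.
Proof. by rewrite win_loE lerDl mulr_ge0// ltW. Qed.

Let mid_win k i : (i < 2 ^ k)%N ->
  win_lo k i < mid lo hi (2 ^ k) i < win_hi k i.
Proof.
move=> iN; have /andP[_ mhi] := mid_itv lohi (N0 k) iN.
rewrite /win_hi lt_min mhi andbT /win_lo /mid /node stepE -(natr1 i.+1) -(natr1 i).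
by have hk := h0 k; lra.
Qed.

Let winD k i t : win_lo k i < t < win_hi k i -> D t.
Proof. by have := win_lo_ge k i; have := win_hi_le k i; rewrite /D => h1 h2 h3; lra. Qed.

Lemma slope_ge0 k i : 0 <= slope k i.
Proof. by rewrite mulr_ge0 ?addr_ge0 ?mulr_ge0// ltW. Qed.

Lemma win_lt k i : (i < 2 ^ k)%N -> win_lo k i < win_hi k i.
Proof. by move=> /mid_win; lra. Qed.

(** A critical point in the window makes the first derivative small there. *)
Lemma critical_slope k i t : (i < 2 ^ k)%N -> critical k i ->
  win_lo k i <= t < win_hi k i -> D t -> `|f1 t| <= slope k i.
Proof.
move=> iN /asboolP[z zw fz] tw tD.
pose P u := win_lo k i <= u < win_hi k i /\ D u.
have Pc s u v : P s -> P u -> s <= v <= u -> P v.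
  by rewrite /P => -[a b] [c d] suv; split; [lra|exact: (Dc b d)].
have PD u : P u -> D u by move=> [].
have Pw u : win_lo k i < u < win_hi k i -> P u.
  by move=> uw; split; [lra|exact: winD uw].
have Pt : P t by [].
have diam u v : P u -> P v -> `|u - v| <= 2 * h k.
  move=> [uw _] [vw _]; rewrite ler_norml; have := win_hi_lo k i; lra.
have Pm := Pw _ (mid_win iN).
have f2P u : P u -> `|f2 u| <= `|f2 (mid lo hi (2 ^ k) i)| + 2 * h k * M3.
  move=> Pu; rewrite -lerBlDl; apply: (le_trans (lerB_dist _ _)).
  apply: le_trans (bounded_deriv_lipschitz Pc (fun u Pu => d3 (PD u Pu))
    (fun u Pu => b3 (PD u Pu)) Pu Pm) _.
  by rewrite mulrC ler_wpM2r//; exact: diam.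
have := bounded_deriv_lipschitz Pc (fun u Pu => d2 (PD u Pu)) f2P Pt (Pw _ zw).
rewrite fz subr0 => /le_trans; apply; rewrite mulrC ler_wpM2r//.
  by rewrite addr_ge0// !mulr_ge0// ltW.
by apply: diam => //; exact: Pw.
Qed.

Let slots k i N c :=
  \sum_(q < N) (`|c - f0 (mid (win_lo k i) (win_hi k i) N q)| <=
    slope k i * step (win_lo k i) (win_hi k i) N)%R%:R : R.

(** The integrable majorant: the points of a level set in a critical window are
    counted by the values of f0 at the midpoints of N subintervals. *)
Definition majorant delta N c : R := w `^ (- delta) *
  (1 + \sum_(k < N) (2 `^ delta) ^+ k.+1 *
     \sum_(i < 2 ^ k | critical k i) slots k i N c).

Let level c := [set t | D t /\ f0 t = c].

(** The points of the level set are at distance e, so they lie in different cells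
    of the window; and f0 is within slope * step of c at the middle of a cell
    that contains one of them. *)
Lemma level_window_count k i N c e : (i < 2 ^ k)%N -> critical k i ->
  (0 < N)%N -> w / N%:R <= e -> finite_set (level c) ->
  (forall x y, level c x -> level c y -> x != y -> e <= `|x - y|) ->
  \sum_(x <- fset_set (level c) | (win_lo k i <= x < win_hi k i)%R) 1 <= slots k i N c.
Proof.
move=> iN cr Npos Ne fin sep; set a := win_lo k i; set b := win_hi k i.
have ab : a < b by exact: win_lt.
have st0 := step_gt0 ab Npos.
have ste : step a b N <= e.
  apply: le_trans Ne; rewrite /step ler_pM2r ?invr_gt0 ?ltr0n//.
  by have := win_lo_ge k i; have := win_hi_le k i; rewrite -/a -/b /lo /hi /w; lra.
have fN x : x \in (fset_set (level c) : seq R) -> a <= x < b -> (cell a b N x < N)%N.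
  by move=> _; exact: cell_lt.
have := @count_le_slots R _ (fset_set (level c)) (fun x => a <= x < b) N
  (fun q => `|c - f0 (mid a b N q)| <= slope k i * step a b N) (cell a b N) fN.
rewrite (_ : \sum_(q < N | _) 1 = slots k i N c); last first.
  by rewrite big_mkcond; apply: eq_bigr => q _; case: ifP.
apply => //.
  move=> x xs xab; have [xD <-] /= : level c x.
    by have := xs; rewrite in_fset_set// inE.
  pose P u := a <= u < b /\ D u.
  have Pc s u v : P s -> P u -> s <= v <= u -> P v.
    by rewrite /P => -[a1 b1] [c1 d1'] suv; split; [lra|exact: (Dc b1 d1')].
  have PD u : P u -> D u by move=> [].
  have Pf1 u : P u -> `|f1 u| <= slope k i.
    by move=> [uab uD]; exact: critical_slope.
  set m := mid _ _ _ _; have mab : a < m < b.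
    by apply: mid_itv => //; exact: cell_lt.
  have Pm : P m by split; [lra|exact: winD mab].
  have := bounded_deriv_lipschitz Pc (fun u Pu => d1 (PD u Pu)) Pf1 (conj xab xD) Pm.
  move=> /le_trans; apply; rewrite ler_wpM2l ?slope_ge0//.
  have /andP[ax _] := xab.
  by apply: (le_trans (cell_mid ab Npos ax)); lra.
move=> x y; rewrite !in_fset_set// !inE => lx ly /andP[ax _] /andP[ay _] xy.
apply/eqP/negPn/negP => nxy.
have := sep _ _ lx ly nxy; rewrite leNgt => /negP; apply.
by apply: lt_le_trans ste; exact: cell_eq_dist.
Qed.

(** Rolle's theorem puts a critical point between two nearby points of a level
    set, inside the window that they share. *)
Lemma crowded_window k c x : level c x -> crowded (level c) (h k) x ->
  exists i : 'I_(2 ^ k), critical k i /\ win_lo k i <= x < win_hi k i.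
Proof.
have half s t : level c s -> level c t -> s < t -> t - s <= h k ->
    exists i : 'I_(2 ^ k), critical k i /\
      (win_lo k i <= s < win_hi k i) /\ (win_lo k i <= t < win_hi k i).
  move=> [sD fs] [tD ft] st sth.
  have sN : (cell lo hi (2 ^ k) s < 2 ^ k)%N.
    by apply: cell_lt => //; move: sD; rewrite /D; lra.
  exists (Ordinal sN) => /=.
  have los : lo <= s by move: sD; rewrite /D; lra.
  have := cell_itv lohi (N0 k) los; rewrite /node stepE -natr1 => sc.
  have tw : t < win_hi k (cell lo hi (2 ^ k) s).
    rewrite /win_hi lt_min /node stepE -(natr1 _.+1) -(natr1 (cell _ _ _ _)); apply/andP; split; first lra.
    by move: tD; rewrite /D; lra.
  have sw : win_lo k (cell lo hi (2 ^ k) s) <= s by rewrite win_loE; lra.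
  split; last by split; lra.
  have [z szt fz] := rolle_root Dc d1 sD tD st (etrans fs (esym ft)).
  by apply/asboolP; exists z => //; lra.
move=> lx /asboolP[y ly [yx xyh]].
have [xy|yx'|xy] := ltgtP x y; last by rewrite xy eqxx in yx.
  have [|i [cr [xw _]]] := half _ _ lx ly xy; last by exists i.
  by rewrite -(gtr0_norm (_ : 0 < y - x)) ?subr_gt0// distrC.
have [|i [cr [_ xw]]] := half _ _ ly lx yx'; last by exists i.
by rewrite -(gtr0_norm (_ : 0 < x - y)) ?subr_gt0.
Qed.

Lemma mdelta_le_majorant delta c e : 0 <= delta -> 0 < e ->
  finite_set (level c) ->
  (forall x y, level c x -> level c y -> x != y -> e <= `|x - y|) ->
  \forall N \near \oo, mdelta rho delta (level c) <= majorant delta N c.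
Proof.
move=> d0 e0 fin sep.
have we : w / e >= 0 by rewrite divr_ge0 ?ltW.
exists (Num.truncn (w / e)).+1 => //= N NN.
have Npos : (0 < N)%N by exact: leq_trans NN.
have weN : w / e < N%:R by rewrite -truncn_lt_nat.
have wNe : w / N%:R < e.
  by rewrite ltr_pdivrMr ?ltr0n// mulrC -ltr_pdivrMr.
apply: le_trans (@mdelta_layers R rho delta (level c) N rho0 d0 fin _ _) _.
- by move=> x [].
- move=> x y lx ly xy; apply: lt_le_trans (sep _ _ lx ly xy).
  apply: le_lt_trans wNe; rewrite ler_pM2l// lef_pV2 ?posrE ?ltr0n ?exprn_gt0//.
  by rewrite -natrX ler_nat ltnW// ltn_expl.
rewrite /majorant ler_pM2l ?powR_gt0// lerD2l; apply: ler_sum => k _.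
rewrite ler_pM2l ?exprn_gt0 ?powR_gt0//.
apply: (@le_trans _ _ (\sum_(i < 2 ^ k | critical k i)
  \sum_(x <- fset_set (level c) | (win_lo k i <= x < win_hi k i)%R) 1)); last first.
  apply: ler_sum => i cr; apply: (level_window_count _ cr Npos (ltW wNe)) => //.
under [leRHS]eq_bigr => i _ do rewrite big_mkcond.
rewrite exchange_big big_mkcond/= big_seq [leRHS]big_seq.
apply: ler_sum => x; rewrite in_fset_set// inE => lx.
case: ifP => [/(crowded_window lx)[i [cr xw]]|_].
  rewrite (bigD1 i)//= xw lerDl sumr_ge0// => j _.
  by case: ifP.
by rewrite sumr_ge0// => j _; case: ifP.
Qed.

(** Between critical windows two apart, the second derivative has a zero, so at
    the first of them it is at most M3 times the distance. *)
Lemma slope_sum k :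
  \sum_(i < 2 ^ k | critical k i) slope k i <= 4 * h k * (M2 + 3 * w * M3).
Proof.
have M2p := M20; have M3p := M30; have hk := h0 k; have Ek := hE k.
have cr_le (P : pred 'I_(2 ^ k)) (x : R) : 0 <= x ->
    \sum_(i < 2 ^ k | P i) x <= (2 ^ k)%:R * x.
  move=> x0; rewrite sumr_const mulr_natl; apply: ler_wpMn2l => //.
  by rewrite -[leqRHS]card_ord max_card.
rewrite -mulr_sumr big_split/=.
have S1 := cr_le (fun i => critical k i) (2 * h k * M3)
  (mulr_ge0 (mulr_ge0 (ler0n R 2) (ltW hk)) M3p).
have S2 : \sum_(i < 2 ^ k | critical k i) `|f2 (mid lo hi (2 ^ k) i)| <=
    2 * M2 + 2 * (2 * M3 * h k) * (2 ^ k)%:R.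
  apply: (@sum_sparse_le R (critical k) (fun i => `|f2 (mid lo hi (2 ^ k) i)|)) => //.
  - by rewrite !mulr_ge0// ltW.
  - by move=> i iN _; apply: b2; exact: winD (mid_win iN).
  move=> i j /asboolP[zi ziw fi] /asboolP[zj zjw fj] ij jN.
  have iN : (i < 2 ^ k)%N by apply: leq_trans jN; rewrite ltnS; apply: leq_trans ij; exact: leq_addr.
  have ijR : i%:R + 2 <= j%:R :> R by rewrite -natrD ler_nat.
  have wij : win_hi k i <= win_lo k j.
    apply: (le_trans (win_hi_lo k i)); rewrite !win_loE.
    by have := ler_wpM2r (ltW hk) ijR; lra.
  have zij : zi < zj by lra.
  have [u uz fu] := rolle_root Dc d2 (winD ziw) (winD zjw) zij (etrans fi (esym fj)).
  have uD : D u by apply: (Dc (winD ziw) (winD zjw)); lra.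
  have mw := mid_win iN; set m := mid lo hi _ _ in mw *.
  have mD : D m := winD mw.
  have := bounded_deriv_lipschitz Dc d3 b3 mD uD; rewrite fu subr0 => /le_trans; apply.
  rewrite (_ : 2 * M3 * _ * _ = M3 * (2 * h k * (j%:R - i%:R))); last by ring.
  rewrite ler_wpM2l// ler_norml.
  have := win_hi_lo k j; have := win_hi_lo k i.
  rewrite !win_loE in ziw zjw mw wij *.
  have := ler_wpM2r (ltW hk) ijR; rewrite mulrDl => E1 E2 E3.
  by apply/andP; split; nra.
have : 2 * h k * (2 * M2 + 2 * (2 * M3 * h k) * (2 ^ k)%:R + (2 ^ k)%:R * (2 * h k * M3))
    = 4 * h k * (M2 + 3 * ((2 ^ k)%:R * h k) * M3) by ring.
rewrite Ek => <-; apply: ler_wpM2l; first by rewrite mulr_ge0// ltW.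
exact: lerD.
Qed.

Let mu := @lebesgue_measure R.

Let band (m r : R) : set R := [set c | `|c - m| <= r].

Lemma lebesgue_band (m r : R) : 0 <= r ->
  measurable (band m r) /\ (mu (band m r) <= (2 * r)%:E)%E.
Proof.
move=> r0; rewrite /band; have -> : [set c : R | `|c - m| <= r] = [set` `[m - r, m + r]].
  by apply/seteqP; split => c; rewrite /= in_itv/= ler_distl.
split; first exact: measurable_itv.
rewrite /mu lebesgue_measure_itv/=; case: ifP => _.
  by rewrite -EFinD lee_fin; lra.
by rewrite lee_fin mulr_ge0.
Qed.

Let measurableD : measurable ([set c | D c] : set R).
Proof.
rewrite (_ : [set c | D c] = [set` `]lo, hi[]); first exact: measurable_itv.
by apply/seteqP; split => c; rewrite /= in_itv.
Qed.

Let muD : (mu [set c | D c] <= w%:E)%E.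
Proof.
rewrite (_ : [set c | D c] = [set` `]lo, hi[]); last first.
  by apply/seteqP; split => c; rewrite /= in_itv.
rewrite /mu lebesgue_measure_itv/= lte_fin lohi -EFinD lee_fin /hi /lo /w.
by lra.
Qed.

(** There are N bands of half-width slope * step, and N * step is the width of
    the window. *)
Lemma slots_int k i N : (0 < N)%N -> (i < 2 ^ k)%N ->
  int_le mu [set c | D c] (slots k i N) (4 * h k * slope k i).
Proof.
move=> N1 iN; have s0 := slope_ge0 k i; have ab := win_lt iN.
have st0 := step_gt0 ab N1.
set r := slope k i * step (win_lo k i) (win_hi k i) N.
have r0 : 0 <= r by rewrite mulr_ge0// ltW.
apply: (@int_le_le _ _ _ _ _ _ (\sum_(q < N) 2 * r)).
  rewrite sumr_const card_ord -(mulr_natl (2 * r)) /r.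
  rewrite (_ : N%:R * _ = 2 * slope k i * (N%:R * step (win_lo k i) (win_hi k i) N)); last by ring.
  rewrite step_mulN// (_ : 4 * _ * _ = 2 * slope k i * (2 * h k)); last by ring.
  apply: ler_wpM2l; first by rewrite mulr_ge0. by have := win_hi_lo k i; lra.
apply: int_le_sum => // q _; have [mA muA] := @lebesgue_band (f0 (mid (win_lo k i) (win_hi k i) N q)) r r0.
rewrite (_ : (fun c => _) = \1_(band (f0 (mid (win_lo k i) (win_hi k i) N q)) r)).
  exact: int_le_indic.
by apply/funext => c; rewrite indicE; congr ((nat_of_bool _)%:R); apply/idP/idP => [/mem_set|/set_mem].
Qed.

(** The k-th layer contributes (2 `^ delta) ^+ k.+1 times a multiple of h k ^+ 2,
    that is a geometric term of ratio 2 `^ delta / 4 < 1. *)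
Lemma majorant_int delta N : 0 < delta -> delta < 2 -> int_le mu [set c | D c]
  (majorant delta N) (w `^ (1 - delta) *
     (1 + 16 * 2 `^ delta / (1 - 2 `^ delta / 4) * (w * M2 + 3 * w ^+ 2 * M3))).
Proof.
move=> de0 de2; have M2p := M20; have M3p := M30; have wp := w0.
set q : R := 2 `^ delta / 4.
have q0 : 0 < q by rewrite divr_gt0 ?powR_gt0.
have q1 : q < 1.
  rewrite ltr_pdivrMr// mul1r (_ : 4 = 2 `^ 2%:R); last by rewrite powR_mulrn//; ring.
  by rewrite /powR pnatr_eq0/= ltr_expR ltr_pM2r// ln_gt0// ltr1n.
set Z := M2 + 3 * w * M3.
have Z0 : 0 <= Z by rewrite addr_ge0 ?mulr_ge0// ltW.
apply: (@int_le_le _ _ _ _ _ _ (w `^ (- delta) * (w + \sum_(k < N) (2 `^ delta) ^+ k.+1 *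
   (16 * h k ^+ 2 * Z)))).
  rewrite (_ : w `^ (1 - delta) = w `^ (- delta) * w); last first.
    by rewrite powRD ?(gt_eqF wp) ?implybT// powRr1 ?ltW// mulrC.
  rewrite -mulrA ler_wpM2l ?powR_ge0// mulrDr mulr1 lerD2l.
  rewrite (eq_bigr (fun k : 'I_N => 16 * 2 `^ delta * w ^+ 2 * Z * q ^+ k)); last first.
    move=> k _; rewrite /q /h !expr_div_n exprS (_ : 4 = 2 ^+ 2); last by ring.
    rewrite -!exprM mulnC.
    by field.
  rewrite -mulr_sumr.
  have geo : \sum_(k < N) q ^+ k <= (1 - q)^-1.
    rewrite -[leRHS]mul1r ler_pdivlMr ?subr_gt0// mulrC.
    have := subrX1 q N; have := exprn_ge0 N (ltW q0).
    by move: (\sum_(_ < _) _) => S; lra.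
  apply: (@le_trans _ _ (16 * 2 `^ delta * w ^+ 2 * Z * (1 - q)^-1)).
    apply: ler_wpM2l => //; rewrite mulr_ge0// mulr_ge0 ?exprn_ge0 ?(ltW wp)//.
  by rewrite le_eqVlt; apply/orP; left; apply/eqP; rewrite /Z; ring.
apply: (@int_le_scale _ _ _ mu _ measurableD _ (fun c => 1 + _) _ (powR_ge0 _ _)).
apply: (@int_le_add _ _ _ mu _ measurableD (fun=> 1)).
  exact: int_le_one.
apply: (@int_le_sum _ _ _ mu _ measurableD 'I_N _ xpredT (fun k c => (2 `^ delta) ^+ k.+1 *
  \sum_(i < 2 ^ k | critical k i) slots k i N c)) => k _.
apply: (@int_le_scale _ _ _ mu _ measurableD _ (fun c => \sum_(i < 2 ^ k | _) _)).
  by rewrite exprn_ge0// powR_ge0.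
apply: (@int_le_le _ _ _ _ _ _ (\sum_(i < 2 ^ k | critical k i) 4 * h k * slope k i)).
  rewrite -mulr_sumr (_ : 16 * h k ^+ 2 * Z = 4 * h k * (4 * h k * Z)); last by ring.
  by apply: ler_wpM2l; [rewrite mulr_ge0// ltW|exact: slope_sum].
apply: (@int_le_sum _ _ _ mu _ measurableD 'I_(2 ^ k) _ (fun i => critical k i)
  (fun i => slots k i N)) => i _; apply: slots_int => //.
by apply: leq_ltn_trans (ltn_ord k).
Qed.

(** The alternative g c = 0 is for the levels that are discarded, a null set in
    the application. *)
Lemma int_mdelta_level delta (g : R -> R) : 0 < delta -> delta < 2 ->
  measurable_fun [set c | D c] g ->
  (forall c, D c -> 0 <= g c) ->
  (forall c, D c -> g c = 0 \/ [/\ g c = mdelta rho delta (level c),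
     finite_set (level c) & exists2 e, 0 < e &
     (forall x y, level c x -> level c y -> x != y -> e <= `|x - y|)]) ->
  int_le mu [set c | D c] g (w `^ (1 - delta) *
     (1 + 16 * 2 `^ delta / (1 - 2 `^ delta / 4) * (w * M2 + 3 * w ^+ 2 * M3))).
Proof.
move=> de0 de2 mg g0 gl.
apply: (@int_le_fatou _ _ _ mu _ measurableD g (majorant delta) _ mg g0).
  by move=> N; exact: majorant_int.
move=> c cD.
case: (gl c cD) => [->|[-> fin [e e0 sep]]].
  by apply: nearW => N; have [_ + _] := majorant_int N de0 de2; exact.
exact: mdelta_le_majorant (ltW de0) e0 fin sep.
Qed.

End one_dim.

(** * Critical values *)

Section sard.
Context {R : realType}.
Variables (rho M2 : R) (f0 f1 f2 : R -> R).
Hypothesis rho0 : 0 < rho.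
Let lo : R := - (2 * rho).
Let hi : R := 2 * rho.
Let D (t : R) := lo < t < hi.
Hypothesis d1 : forall t : R, D t -> is_derive t 1 f0 (f1 t).
Hypothesis d2 : forall t : R, D t -> is_derive t 1 f1 (f2 t).
Hypothesis b2 : forall t, D t -> `|f2 t| <= M2.

(** Sard's theorem on an interval: near a critical point the function moves by
    the square of the mesh only, so the almost critical values are covered by N
    bands of total length of order 1 / N. *)
Lemma sard_null (B : set R) : measurable B ->
  (forall c, B c -> ~ regular_on lo hi (fun t => f0 t - c) f1) ->
  lebesgue_measure B = 0%E.
Proof.
move=> mB nreg; have r0 := rho0.
have lohi : lo < hi by rewrite /lo /hi; lra.
have Dc s t u : D s -> D t -> s <= u <= t -> D u by rewrite /D => *; lra.
have M20 : 0 <= M2.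
  by apply: le_trans (b2 (_ : D 0)) => //; rewrite /D /lo /hi; lra.
set w := hi - lo; have w0 : 0 < w by rewrite subr_gt0.
have cover N : (0 < N)%N -> w <= N%:R ->
    (lebesgue_measure B <= (2 * w ^+ 2 * (2 + M2) / N%:R)%:E)%E.
  move=> N0 wN; set h := step lo hi N; have h0 : 0 < h := step_gt0 lohi N0.
  have hE : N%:R * h = w := step_mulN lo hi N0.
  have h1 : h <= 1 by rewrite /h /step ler_pdivrMr ?ltr0n// mul1r.
  (* within h of an almost critical point, |f1| is at most h ^+ 2 + M2 * h *)
  pose r := h ^+ 2 + (h ^+ 2 + M2 * h) * h.
  have h0' := ltW h0.
  have rp : 0 <= r.
    apply: addr_ge0; first exact: exprn_ge0.
    by apply: mulr_ge0 => //; apply: addr_ge0; [exact: exprn_ge0|exact: mulr_ge0].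
  pose band q := [set` `[f0 (mid lo hi N q) - r, f0 (mid lo hi N q) + r]] : set R.
  have muband q : (lebesgue_measure (band q) <= (2 * r)%:E)%E.
    rewrite lebesgue_measure_itv/=; case: ifP => _.
      by rewrite -EFinD lee_fin; lra.
    by rewrite lee_fin mulr_ge0.
  have Bcov : B `<=` \big[setU/set0]_(q < N) band q.
    move=> c /nreg ncr; rewrite -bigcup_mkord.
    have [t [tD ft]] : exists t, D t /\ `|f0 t - c| + `|f1 t| < h ^+ 2.
      apply: contrapT => nt; apply: ncr; exists (h ^+ 2); first by rewrite exprn_gt0.
      by move=> t tD; rewrite leNgt; apply/negP => ft; apply: nt; exists t.
    have tD' : lo <= t < hi by move: tD; rewrite /D; lra.
    have qN : (cell lo hi N t < N)%N by exact: cell_lt.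
    exists (cell lo hi N t) => //; set m := mid lo hi N (cell lo hi N t).
    have mD : D m by exact: mid_itv.
    have /andP[lot _] := tD'.
    have tm : `|t - m| <= h / 2 := cell_mid lohi N0 lot.
    pose P u := D u /\ `|t - u| <= h.
    have Pc s u v : P s -> P u -> s <= v <= u -> P v.
      move=> [sD ts] [uD tu] suv; split; first exact: (Dc _ _ _ sD uD).
      by move: ts tu; rewrite !ler_norml => *; lra.
    have Pt : P t by split => //; rewrite subrr normr0 ltW.
    have Pm : P m by split => //; lra.
    have f1P u : P u -> `|f1 u| <= h ^+ 2 + M2 * h.
      move=> [uD tu]; have := bounded_deriv_lipschitz Dc d2 b2 uD tD.
      rewrite distrC => fut; have : `|f1 t| <= h ^+ 2.
        by have := normr_ge0 (f0 t - c); lra.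
      have : M2 * `|u - t| <= M2 * h by apply: ler_wpM2l => //; rewrite distrC.
      have := ler_normD (f1 t) (f1 u - f1 t); rewrite (addrC (f1 t)) subrK (distrC (f1 u)).
      by lra.
    have ftm := bounded_deriv_lipschitz Pc (fun u Pu => d1 Pu.1) f1P Pt Pm.
    have {}ftm : `|f0 t - f0 m| <= (h ^+ 2 + M2 * h) * h.
      apply: (le_trans ftm); apply: ler_wpM2l; last lra.
      by apply: addr_ge0; [exact: exprn_ge0|exact: mulr_ge0].
    have ftc : `|f0 t - c| <= h ^+ 2 by have := normr_ge0 (f1 t); lra.
    rewrite /band /= in_itv/= -ler_distl /r distrC.
    have := ler_distD (f0 t) (f0 m) c; rewrite (distrC (f0 m) (f0 t)); lra.
  apply: (@le_trans _ _ (\sum_(q < N) (2 * r)%:E)%E).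
    have mband q : `I_N q -> measurable (band q) by move=> _; exact: measurable_itv.
    apply: (le_trans (@content_subadditive _ _ _ lebesgue_measure _ _ _ mband mB Bcov)).
    apply: lee_sum => q _; exact: muband.
  rewrite sumEFin lee_fin sumr_const card_ord -(mulr_natl (2 * r)).
  have -> : 2 * w ^+ 2 * (2 + M2) / N%:R = 2 * w * (2 + M2) * h.
    by rewrite /h /step -/w; ring.
  have -> : N%:R * (2 * r) = 2 * w * (h + h ^+ 2 + M2 * h) by rewrite -hE /r; ring.
  rewrite -[leRHS]mulrA; apply: ler_wpM2l; first by rewrite mulr_ge0// ltW.
  have : h * h <= 1 * h by rewrite ler_wpM2r// ltW.
  by rewrite expr2; lra.
apply/eqP; rewrite eq_le measure_ge0 andbT; apply/lee_addgt0Pr => e e0.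
rewrite add0e; pose K := 2 * w ^+ 2 * (2 + M2).
have K0 : 0 <= K.
  have wp := ltW w0; apply: mulr_ge0; last exact: addr_ge0.
  by apply: mulr_ge0 => //; exact: exprn_ge0.
pose N := (Num.truncn (w + K / e)).+1.
have NK : w + K / e < N%:R by exact: truncnS_gt.
have Ke : 0 <= K / e by rewrite divr_ge0// ltW.
apply: le_trans (cover N _ _) _ => //; first by lra.
rewrite lee_fin -/K ler_pdivrMr ?ltr0n// mulrC -ler_pdivrMr//; lra.
Qed.

End sard.

(** * Measurability of the root set *)

Section measurable_roots.
Context {d} {T : measurableType d} {R : realType}.
Variables (A : set T) (mA : measurable A) (lo hi : R) (lohi : lo < hi).
Variables (F f : T -> R -> R).
Hypothesis mF : forall t, lo < t < hi -> measurable_fun A (F^~ t).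
Hypothesis mf : forall t, lo < t < hi -> measurable_fun A (f^~ t).
Hypothesis cF : forall x t, A x -> lo < t < hi -> {for t, continuous (F x)}.
Hypothesis cf : forall x t, A x -> lo < t < hi -> {for t, continuous (f x)}.

Definition roots x := [set t | lo < t < hi /\ F x t = 0].

Let rat_near (g : R -> R) (t a b e : R) : {for t, continuous g} -> a < b ->
  a <= t <= b -> 0 < e -> exists2 q : rat, a < ratr q < b & `|g t - g (ratr q)| < e.
Proof.
move=> ct ab tab e0.
have : \forall s \near t, `|g t - g s| < e by move/cvgrPdist_lt: ct; exact.
move=> /nbhs_ballP[r /= r0 H].
have [|q] := @rat_in_itvoo R (Num.max a (t - r)) (Num.min b (t + r)).
  by rewrite lt_min !gt_max; apply/andP; split; apply/andP; split; lra.
rewrite in_itv/= gt_max lt_min => /andP[/andP[q1 q2] /andP[q3 q4]].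
exists q; first by rewrite q1.
by apply: H; rewrite /ball/= ltr_norml; lra.
Qed.

(** By compactness, F x vanishes on a segment as soon as it is arbitrarily small
    at rational points of it. *)
Lemma measurable_root_in_segment a b : lo < a -> a < b -> b < hi ->
  measurable [set x | A x /\ exists2 t, a <= t <= b & F x t = 0].
Proof.
move=> loa ab bhi.
have -> : [set x | A x /\ exists2 t, a <= t <= b & F x t = 0] =
  \bigcap_(k : nat) \bigcup_(q : rat) (if a < ratr q < b then
    A `&` [set x | `|F x (ratr q)| < k.+1%:R^-1] else set0).
  apply/seteqP; split=> [x [Ax [t tab Ft]] k _ | x H].
    have tD : lo < t < hi by lra.
    have [|q qab qF] := @rat_near (F x) t a b k.+1%:R^-1 (cF Ax tD) ab tab.
      by rewrite invr_gt0.
    by exists q => //; rewrite qab; split => //=; rewrite Ft sub0r normrN in qF.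
  have Ax : A x by have [q _] := H 0%N I; case: ifP => // _ [].
  split => //; apply: contrapT => noroot.
  have cab : {within `[a, b], continuous (fun t => `|F x t|)}.
    apply: continuous_in_subspaceT => t; rewrite inE/= in_itv/= => tab.
    apply: (continuous_comp (cF Ax _)); first lra.
    exact: norm_continuous.
  have [c + cmin] := EVT_min (ltW ab) cab; rewrite in_itv/= => cab'.
  have Fc0 : 0 < `|F x c|.
    by rewrite normr_gt0; apply/eqP => Fc; apply: noroot; exists c.
  have inv0 : 0 <= `|F x c|^-1 by rewrite invr_ge0.
  pose k := Num.truncn (`|F x c|^-1).
  have kF : k.+1%:R^-1 < `|F x c|.
    by rewrite -[ltRHS]invrK ltf_pV2 ?posrE ?invr_gt0// truncnS_gt.
  have [q _] := H k I; case: ifP => // qab [_ /= Fq].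
  have qI : ratr q \in `[a, b] by rewrite in_itv/=; lra.
  have cq : `|F x c| <= `|F x (ratr q)| := cmin _ qI.
  by have := lt_trans (le_lt_trans cq Fq) kF; rewrite ltxx.
apply: bigcapT_measurable => k; apply: bigcupT_measurable_rat => q.
case: ifP => // qab; have qD : lo < ratr q < hi by lra.
have mN : measurable_fun A (fun x => `|F x (ratr q)|).
  by apply: measurableT_comp => //; exact: mF.
have := mN mA `]-oo, k.+1%:R^-1[%classic (measurable_itv _).
by congr (measurable _); apply/seteqP; split => x /=; rewrite in_itv.
Qed.

(** A cell is a countable union of segments inside the open interval; its left end
    is excluded only when it is lo. *)
Lemma measurable_root_in_cell a b : lo <= a -> a < b -> b <= hi ->
  measurable [set x | A x /\ exists2 t, roots x t & a <= t < b].
Proof.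
move=> loa ab bhi; set s := b - a; have s0 : 0 < s by rewrite subr_gt0.
(* with m.+3, the two ends stay in order even when a = lo *)
pose am m : R := Num.max a (lo + s / m.+3%:R).
pose bm m : R := b - s / m.+3%:R.
have sm m : 0 < s / m.+3%:R <= s / 3.
  rewrite divr_gt0//= ler_pM2l// lef_pV2 ?posrE//.
  by rewrite ler_nat.
have am_bm m : [/\ lo < am m, am m < bm m & bm m < hi].
  have := sm m; have sE : s = b - a by [].
  rewrite /am /bm; move: (s / m.+3%:R) => e /andP[e1 e2]; rewrite sE in e2.
  split; first by rewrite lt_max; apply/orP; right; lra.
    by rewrite gt_max; apply/andP; split; lra.
  by lra.
have -> : [set x | A x /\ exists2 t, roots x t & a <= t < b] =
   \bigcup_(m : nat) [set x | A x /\ exists2 t, am m <= t <= bm m & F x t = 0].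
  apply/seteqP; split=> [x [Ax [t [tD Ft] tab]]|x [m _ [Ax [t tab Ft]]]].
    pose e : R := Num.min (t - lo) (b - t).
    have e0 : 0 < e by rewrite lt_min !subr_gt0; lra.
    pose m := Num.truncn (s / e).
    have me : s / m.+3%:R <= e.
      rewrite ler_pdivrMr// mulrC -ler_pdivrMr//.
      have := truncnS_gt (s / e); rewrite -/m => h.
      by apply: (le_trans (ltW h)); rewrite ler_nat -addn2 leq_addr.
    exists m => //; split => //; exists t => //.
    move: me; rewrite le_min /am /bm ge_max.
    move: (s / m.+3%:R) => u /andP[u1 u2].
    by apply/andP; split; [apply/andP; split|]; lra.
  have [h1 h2 h3] := am_bm m.
  split => //; exists t; first by split => //; lra.
  have : a <= am m by rewrite /am le_max lexx.
  have := sm m; move: tab; rewrite /bm.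
  by move: (s / m.+3%:R) => u tab /andP[u1 u2] aam; lra.
apply: bigcupT_measurable => m; have [h1 h2 h3] := am_bm m.
exact: measurable_root_in_segment.
Qed.

(** The lower bound is tested at rational points, by continuity. *)
Lemma measurable_regular : measurable [set x | A x /\ regular_on lo hi (F x) (f x)].
Proof.
have -> : [set x | A x /\ regular_on lo hi (F x) (f x)] =
  \bigcup_(k : nat) \bigcap_(q : rat) (if lo < ratr q < hi then
    A `&` [set x | k.+1%:R^-1 <= `|F x (ratr q)| + `|f x (ratr q)|] else A).
  apply/seteqP; split=> [x [Ax [e e0 H]]|x [k _ H]].
    have inv0 : 0 <= e^-1 by rewrite invr_ge0 ltW.
    exists (Num.truncn e^-1) => // q _; case: ifP => // qD; split => //=.
    apply: le_trans (H _ qD); rewrite -[leRHS]invrK lef_pV2 ?posrE ?invr_gt0//.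
    by rewrite ltW// truncnS_gt.
  have Ax : A x by have := H 0 I; case: ifP => // _ [].
  split => //; exists k.+1%:R^-1; first by rewrite invr_gt0.
  move=> t tD; rewrite leNgt; apply/negP => lt.
  pose g s := `|F x s| + `|f x s|.
  have cg : {for t, continuous g}.
    apply: continuousD.
      by apply: (continuous_comp (cF Ax tD)); exact: norm_continuous.
    by apply: (continuous_comp (cf Ax tD)); exact: norm_continuous.
  have tD' : lo <= t <= hi by lra.
  have e0 : 0 < k.+1%:R^-1 - g t by rewrite subr_gt0.
  have [q qD qg] := rat_near cg lohi tD' e0.
  have gq : k.+1%:R^-1 <= g (ratr q) by have := H q I; rewrite qD => -[].
  have : g (ratr q) - g t < k.+1%:R^-1 - g t.
    by apply: le_lt_trans qg; rewrite distrC ler_norm.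
  by rewrite ltrD2r ltNge gq.
apply: bigcupT_measurable => k; rewrite -[X in measurable X]setCK setC_bigcap.
apply: measurableC; apply: bigcupT_measurable_rat => q; apply: measurableC.
case: ifP => // qD.
have mN : measurable_fun A (fun x => `|F x (ratr q)| + `|f x (ratr q)|).
  by apply: measurable_funD; apply: measurableT_comp => //; [exact: mF|exact: mf].
have := mN mA `[k.+1%:R^-1, +oo[%classic (measurable_itv _).
by congr (measurable _); apply/seteqP; split => x /=; rewrite in_itv/= andbT.
Qed.

Variable N : nat.
Hypothesis N0 : (0 < N)%N.

Definition cell_hit (q : 'I_N) x :=
  `[< exists2 t, roots x t & cell lo hi N t = q >].

Let round t := mid lo hi N (cell lo hi N t).

Lemma measurable_cell_hit q : measurable [set x | A x /\ cell_hit q x].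
Proof.
have st0 := step_gt0 lohi N0.
have nlt : node lo hi N q < node lo hi N q.+1.
  by rewrite /node -natr1 mulrDl mul1r ltrD2l ltrDl.
have nlo : lo <= node lo hi N q by rewrite /node lerDl mulr_ge0// ltW.
have nhi : node lo hi N q.+1 <= hi.
  rewrite /node -lerBrDl -(step_mulN lo hi N0).
  by apply: ler_wpM2r; [exact: ltW|rewrite ler_nat].
have := measurable_root_in_cell nlo nlt nhi; congr (measurable _).
apply/seteqP; split => x [Ax] => [[t rt tq]|/asboolP[t rt tq]].
  split => //; apply/asboolP; exists t => //.
  move: tq; rewrite /node /cell => /andP[t1 t2].
  by apply: truncn_def; rewrite ler_pdivlMr// ltr_pdivrMr// -/(step lo hi N); lra.
split => //; exists t => //; rewrite -tq; apply: cell_itv => //.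
by have [+ _] := rt; lra.
Qed.

(** Moving every root to the middle of its cell leaves finitely many possible
    sets, each recorded by the family of cells that contain a root. *)
Lemma measurable_rounded (g : set R -> R) :
  measurable_fun A (fun x => g (round @` roots x)).
Proof.
pose E (S : {set 'I_N}) := [set x | A x /\ forall q, (q \in S) = cell_hit q x].
have mE S : measurable (E S).
  have -> : E S = A `&` \bigcap_(q in [set: 'I_N]) (if q \in S then
      [set x | A x /\ cell_hit q x] else A `\` [set x | A x /\ cell_hit q x]).
    apply/seteqP; split=> [x [Ax xS]|x [Ax H]]; split => // q.
      move=> _; rewrite xS; case: ifPn => //= /negP nh.
      by split => // -[].
    have := H q I; case: ifPn => _ /=; first by case=> _ ->.
    by move=> [_ nh]; apply/esym/negP => h; apply: nh.
  apply: measurableI => //; apply: fin_bigcap_measurable => // q _.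
  case: ifP => _; first exact: measurable_cell_hit.
  by apply: measurableD => //; exact: measurable_cell_hit.
pose mids (S : {set 'I_N}) := [set mid lo hi N q | q in [set q : 'I_N | q \in S]].
apply: (@eq_measurable_fun _ _ _ _ A (fun x => \sum_(S : {set 'I_N}) \1_(E S) x * g (mids S))).
  move=> x /set_mem Ax; pose S := [set q : 'I_N | cell_hit q x]%SET.
  have ES : E S x by split => // q; rewrite inE.
  rewrite (bigD1 S)//= big1 ?addr0 => [|S' SS'].
    rewrite indicE mem_set// mul1r; congr (g _).
    apply/seteqP; split=> [_ [q + <-]|_ [t rt <-]].
      rewrite /= inE => /asboolP[t rt tq].
      by exists t => //; rewrite /round tq.
    have tN : (cell lo hi N t < N)%N.
      by apply: cell_lt => //; have [+ _] := rt; lra.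
    by exists (Ordinal tN) => //=; rewrite inE; apply/asboolP; exists t.
  rewrite indicE; case: (boolP (x \in E S')) => [/set_mem[_ ES']|]; last by rewrite mul0r.
  suff SE : S' = S by rewrite SE eqxx in SS'.
  by apply/setP => q; rewrite ES' inE.
apply: measurable_sum => S; apply: measurable_funM => //.
Qed.

End measurable_roots.

Section measurable_mdelta.
Context {d} {T : measurableType d} {R : realType}.
Variables (A : set T) (mA : measurable A) (lo hi : R) (lohi : lo < hi).
Variables (F f : T -> R -> R).
Hypothesis mF : forall t, lo < t < hi -> measurable_fun A (F^~ t).
Hypothesis mf : forall t, lo < t < hi -> measurable_fun A (f^~ t).
Hypothesis cF : forall x t, A x -> lo < t < hi -> {for t, continuous (F x)}.
Hypothesis cf : forall x t, A x -> lo < t < hi -> {for t, continuous (f x)}.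

(** A limit of functions of rounded root sets, as the mesh goes to 0. *)
Lemma measurable_mdelta_roots (rho delta : R) : 0 < rho ->
  (forall x, A x -> regular_on lo hi (F x) (f x) -> finite_set (roots lo hi F x)) ->
  measurable_fun A (fun x => mdelta rho delta (roots lo hi F x) *
    \1_[set x | A x /\ regular_on lo hi (F x) (f x)] x).
Proof.
move=> rho0 fin; set G := [set x | _].
have mG : measurable G by exact: measurable_regular.
pose r p t := mid lo hi p.+1 (cell lo hi p.+1 t).
apply: (@measurable_fun_cvg _ _ _ _
  (fun p x => mdelta rho delta (r p @` roots lo hi F x) * \1_G x)).
  move=> p; apply: measurable_funM; last exact: measurable_indic.
  exact: (measurable_rounded mA lohi mF cF (ltn0Sn p)).
move=> x Ax; case: (pselect (G x)) => [Gx|nGx]; last first.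
  have E : \1_G x = 0 :> R by rewrite indicE memNset.
  by rewrite E mulr0; under eq_fun do rewrite mulr0; exact: cvg_cst.
apply: cvgMr_tmp.
apply: (@mdelta_round_cvg _ _ _ _ r (fun p => (hi - lo) * harmonic p) rho0 (fin x Ax Gx.2)).
  by rewrite -[X in _ --> X](mulr0 (hi - lo)); apply: cvgMl_tmp; exact: cvg_harmonic.
move=> p t [tD _]; have lot : lo <= t by lra.
have := cell_mid lohi (ltn0Sn p) lot; have := step_gt0 lohi (ltn0Sn p).
rewrite /r distrC => h1 h2; apply: (le_trans h2).
by rewrite ler_pdivrMr// ler_peMr ?ler1n// ltW.
Qed.

End measurable_mdelta.

(** * Integration and measurability on row vectors *)

Section insertion.
Context {R : realType}.

(** Inserts c into y at the position l: the inverse of deleting a coordinate. *)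
Definition insert_coord n (l : 'I_n.+1) (c : R) (y : 'rV[R]_n) : 'rV[R]_n.+1 :=
  \row_i oapp (y ord0) c (unlift l i).

Lemma insert_coord_at n (l : 'I_n.+1) c y : insert_coord l c y ord0 l = c.
Proof. by rewrite mxE unlift_none. Qed.

Lemma insert_coord_lift n (l : 'I_n.+1) c y j : insert_coord l c y ord0 (lift l j) = y ord0 j.
Proof. by rewrite mxE liftK. Qed.

Lemma insert_coord0 n (p : measurableTypeR R * 'rV[R]_n) : consrV p = insert_coord ord0 p.1 p.2.
Proof. by []. Qed.

Lemma col'_insert_coord n (l : 'I_n.+1) c y : col' l (insert_coord l c y) = y.
Proof. by apply/rowP => j; rewrite mxE insert_coord_lift. Qed.

Lemma insert_coord_col' n (l : 'I_n.+1) (x : 'rV[R]_n.+1) : insert_coord l (x ord0 l) (col' l x) = x.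
Proof.
apply/rowP => i; have [j ->|->] := unliftP l i; last by rewrite insert_coord_at.
by rewrite insert_coord_lift mxE.
Qed.

Lemma insert_coord_consrV n (l : 'I_n.+1) (c0 c : R) (y : 'rV[R]_n) :
  insert_coord (lift ord0 l) c (consrV (c0, y)) = consrV (c0, insert_coord l c y).
Proof.
rewrite !insert_coord0 /=; apply/rowP => i.
have [j ->|->] := unliftP ord0 i; last first.
  rewrite insert_coord_at (_ : ord0 = lift (lift ord0 l) ord0); last exact/val_inj.
  by rewrite insert_coord_lift insert_coord_at.
rewrite insert_coord_lift; have [k ->|->] := unliftP l j; last by rewrite !insert_coord_at.
rewrite insert_coord_lift (_ : lift ord0 (lift l k) = lift (lift ord0 l) (lift ord0 k)).
  by rewrite !insert_coord_lift.
by apply/val_inj; rewrite /= /bump !leq0n !add1n ltnS; case: (leq l k).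
Qed.

Lemma measurable_insert_coord n (l : 'I_n.+1) : measurable_fun
  [set: measurableTypeR R * 'rV[R]_n] (fun p => insert_coord l p.1 p.2).
Proof.
apply: measurable_fun_rV => i; have [j ->|->] := unliftP l i.
  under eq_fun do rewrite insert_coord_lift.
  exact: (measurableT_comp (measurable_coord j) measurable_snd).
under eq_fun do rewrite insert_coord_at; exact: measurable_fst.
Qed.

Local Open Scope ereal_scope.

Lemma integral_consrV n (f : 'rV[R]_n.+1 -> \bar R) : measurable_fun setT f ->
  (forall x, 0 <= f x) ->
  \int[lebesgue_rV n.+1]_x f x =
  \int[lebesgue_measure]_c \int[lebesgue_rV n]_y f (consrV (c, y)).
Proof.
move=> mf f0.
have mfc : measurable_fun setT (f \o @consrV R n).
  by apply: measurableT_comp => //; exact: measurable_consrV.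
rewrite -(fubini_tonelli1 _ mfc (fun=> f0 _)).
have := ge0_integral_pushforward (@measurable_consrV R n)
  (product_measure1 lebesgue_measure (lebesgue_rV n)) measurableT mf (fun x _ => f0 x).
rewrite preimage_setT; exact.
Qed.

(** Fubini's theorem for the coordinate l. The measure is built by adding
    coordinates in front, so the first one is exchanged by Fubini's theorem, and
    the others are reached by induction under the integral over the first. *)
Lemma integral_insert_coord n (l : 'I_n.+1) (f : 'rV[R]_n.+1 -> \bar R) :
  measurable_fun setT f -> (forall x, 0 <= f x) ->
  \int[lebesgue_rV n.+1]_x f x =
  \int[lebesgue_rV n]_y \int[lebesgue_measure]_c f (insert_coord l c y).
Proof.
have base m (g : 'rV[R]_m.+1 -> \bar R) : measurable_fun setT g ->
    (forall x, 0 <= g x) -> \int[lebesgue_rV m.+1]_x g x =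
    \int[lebesgue_rV m]_y \int[lebesgue_measure]_c g (insert_coord ord0 c y).
  move=> mg g0; rewrite integral_consrV//.
  have mgc : measurable_fun setT (g \o @consrV R m).
    by apply: measurableT_comp => //; exact: measurable_consrV.
  exact: (fubini_tonelli _ mgc (fun=> g0 _)).
elim: n l f => [|n IH] l f mf f0.
  by rewrite ord1; exact: base.
have [l' ->|->] := unliftP ord0 l; last exact: base.
have mfc c0 : measurable_fun setT (fun x => f (consrV (c0, x))).
  apply: measurableT_comp => //.
  apply: (measurableT_comp (@measurable_consrV R n.+1)).
  exact: measurable_fun_pair.
rewrite integral_consrV//; under eq_integral => c0 _ do rewrite (IH l')//.
rewrite [RHS]integral_consrV; last 2 first.
- have mfi : measurable_fun setT (f \o (fun p : measurableTypeR R * 'rV[R]_n.+1 => insert_coord (lift ord0 l') p.1 p.2)).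
    by apply: measurableT_comp => //; exact: measurable_insert_coord.
  exact: (measurable_fun_fubini_tonelli_G _ mfi (fun=> f0 _)).
- by move=> y; apply: integral_ge0.
apply: eq_integral => c0 _; apply: eq_integral => y _; apply: eq_integral => c _.
by rewrite insert_coord_consrV.
Qed.

End insertion.

Section row_vectors.
Context {R : realType}.

Definition rV_box n (a b : 'rV[R]_n) : set 'rV[R]_n :=
  [set x | forall i, a ord0 i < x ord0 i < b ord0 i].

Lemma measurable_rV_box n (a b : 'rV[R]_n) : measurable (rV_box a b).
Proof.
rewrite (_ : rV_box a b = \bigcap_(i in [set: 'I_n])
    ((fun x : 'rV[R]_n => x ord0 i) @^-1` [set` `]a ord0 i, b ord0 i[])).
  apply: fin_bigcap_measurable => // i _.
  rewrite -[X in measurable X]setTI; exact: measurable_coord.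
by apply/seteqP; split=> x /= abx i => [_|]; have := abx i; rewrite /= in_itv/=;
  [|apply].
Qed.

(** Every point of an open set lies in a rational box inside that set. *)
Lemma open_measurable_rV n (U : set 'rV[R]_n) : open U -> measurable U.
Proof.
move=> oU.
pose rx (q : 'rV[rat]_n) : 'rV[R]_n := \row_i ratr (q ord0 i).
have -> : U = \bigcup_(p : 'rV[rat]_n * 'rV[rat]_n)
    (if `[< rV_box (rx p.1) (rx p.2) `<=` U >] then rV_box (rx p.1) (rx p.2) else set0).
  apply/seteqP; split=> [x Ux|x [p _]]; last by case: asboolP => // pU; exact: pU.
  have /nbhs_ballP[e /= e0 xeU] : nbhs x U by exact: open_nbhs_nbhs.
  have ex i : exists pq : rat * rat,
      [/\ x ord0 i - e < ratr pq.1 < x ord0 i & x ord0 i < ratr pq.2 < x ord0 i + e].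
    have [|p] := @rat_in_itvoo R (x ord0 i - e) (x ord0 i); first lra.
    have [|q] := @rat_in_itvoo R (x ord0 i) (x ord0 i + e); first lra.
    by rewrite !in_itv/= => qx px; exists (p, q).
  have [g gP] := choice ex.
  exists (\row_i (g i).1, \row_i (g i).2) => //=.
  rewrite ifT; last first.
    apply/asboolP => y yb; apply: xeU; split => // i j; rewrite ord1.
    have [g1 g2] := gP j; have := yb j; rewrite !mxE => gy.
    by rewrite /ball/= ltr_norml; lra.
  by move=> i; have [g1 g2] := gP i; rewrite !mxE; lra.
apply: countable_bigcupT_measurable; first exact: countableP.
by move=> p; case: ifP => // _; exact: measurable_rV_box.
Qed.

Lemma measurable_fun_continuous_rV n (A : set 'rV[R]_n) (f : 'rV[R]_n -> R) :
  open A -> (forall x, A x -> {for x, continuous f}) -> measurable_fun A f.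
Proof.
move=> oA cf; apply: (measurability _ (RGenOInfty.measurableE R)) => //.
move=> _ [_ [a ->] <-]; apply: open_measurable_rV.
rewrite openE => x [Ax /=]; rewrite in_itv/= andbT => fxa; rewrite /interior.
apply: filterI; first exact: open_nbhs_nbhs.
have fx : \forall y \near x, a < f y by exact: cvgr_gt (cf x Ax) _ fxa.
by apply: filterS fx => y; rewrite /= in_itv/= andbT.
Qed.

Lemma lebesgue_open_gt0 n (U : set 'rV[R]_n) x : open U -> U x ->
  (0 < lebesgue_rV n U)%E.
Proof.
move=> oU Ux; have /nbhs_ballP[e /= e0 xeU] : nbhs x U by exact: open_nbhs_nbhs.
pose a : 'rV[R]_n := \row_i (x ord0 i - e).
pose b : 'rV[R]_n := \row_i (x ord0 i + e).
have ab i : a ord0 i <= b ord0 i by rewrite !mxE; lra.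
apply: (@lt_le_trans _ _ (lebesgue_rV n (rV_box a b))).
  rewrite lebesgue_rV_box// lte_fin prodr_gt0// => i _.
  by rewrite !mxE; lra.
apply: le_measure; rewrite ?inE; [exact: measurable_rV_box|exact: open_measurable_rV|].
move=> y yb; apply: xeU; split => // i j; rewrite ord1.
have := yb j; rewrite !mxE => yj.
by rewrite /ball/= ltr_norml; lra.
Qed.

Lemma lebesgue_rV_cube n (rho : R) : 0 < rho ->
  lebesgue_rV n (cube n rho) = ((4 * rho) ^+ n)%:E.
Proof.
move=> rho0; have := @lebesgue_rV_box R n (const_mx (- (2 * rho))) (const_mx (2 * rho)).
rewrite (eq_bigr (fun=> 4 * rho)) => [|i _]; last by rewrite !mxE; lra.
rewrite prodr_const card_ord => <-; last by move=> i; rewrite !mxE; lra.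
by congr (lebesgue_rV n _); apply/seteqP; split => x xc i; have := xc i; rewrite !mxE.
Qed.

Lemma open_cube n (rho : R) : open (cube n rho).
Proof.
rewrite openE => x xc; rewrite /interior; rewrite /cube.
apply: (@filter_forall _ 'I_n (fun i (y : 'rV[R]_n) => - (2 * rho) < y ord0 i < 2 * rho) (nbhs x)) => i.
have /= xi : x ord0 i \in `]- (2 * rho), 2 * rho[ by rewrite in_itv/=; exact: xc.
have cx : {for x, continuous (fun y : 'rV[R]_n => y ord0 i)} by exact: coord_continuous.
have nx : nbhs x ((fun y : 'rV[R]_n => y ord0 i) @^-1` [set z | z \in `]- (2 * rho), 2 * rho[]).
  by apply: cx; exact: near_in_itvoo.
by apply: filterS nx => y; rewrite /= in_itv.
Qed.

Lemma measurable_cube n (rho : R) : measurable (cube n rho).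
Proof. by apply: open_measurable_rV; exact: open_cube. Qed.

(** The closure lies in a product of segments. *)
Lemma compact_closure_cube n (rho : R) : compact (closure (cube n rho)).
Proof.
apply: (subclosed_compact (@closed_closure _ _)
  (@rV_compact R n (fun=> [set` `[- (2 * rho), 2 * rho]]) _)).
  by move=> i; exact: segment_compact.
move=> v clv i; apply: contrapT; rewrite /= in_itv/= => /negP.
rewrite negb_and -!ltNge => vi.
pose e := Num.max (- (2 * rho) - v ord0 i) (v ord0 i - 2 * rho).
have e0 : 0 < e by rewrite lt_max !subr_gt0.
have [y [yc yv]] := clv (ball v e) (nbhsx_ballx v e e0).
have := yc i; have := yv.2 ord0 i; rewrite /ball/= ltr_norml /e.
by case: (lerP (- (2 * rho) - v ord0 i) (v ord0 i - 2 * rho)) => h1 h2 h3; lra.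
Qed.

(** On an open set, a bound that holds almost everywhere holds at every point
    of continuity. *)
Lemma le_Linfty_norm n (A : set 'rV[R]_n) (g F : 'rV[R]_n -> R) x : open A ->
  (forall x, A x -> {for x, continuous g}) -> (forall x, A x -> `|g x| <= F x) ->
  A x -> (`|g x|%:E <= Linfty_norm A F)%E.
Proof.
move=> oA cg gF Ax; have mu0 : (0 < @lebesgue_rV R n setT)%E.
  exact: (lebesgue_open_gt0 openT (I : [set: _] x)).
rewrite /Linfty_norm unlock mu0; set L := ess_sup _ _.
rewrite leNgt; apply/negP => Lg.
have [r Lr rg] : exists2 r : R, (L <= r%:E)%E & r < `|g x|.
  case: (L) Lg => [r||] Lg; [by exists r|by []|].
  by exists (`|g x| - 1); rewrite ?leNye// ltrBlDr ltrDl.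
pose U := A `&` [set y | r < `|g y|].
have oU : open U.
  rewrite openE => y [Ay /= ry]; rewrite /interior.
  apply: filterI; first exact: open_nbhs_nbhs.
  have cN : {for y, continuous (fun y => `|g y|)}.
    by apply: (continuous_comp (cg y Ay)); exact: norm_continuous.
  exact: (cvgr_gt _ cN _ ry).
have [N [mN N0 HN]] : (\forall y \ae lebesgue_rV n, ((abse \o (EFin \o F) \_ A) y <= r%:E)%E).
  exact/ess_supP.
have UN : U `<=` N.
  move=> y [Ay ry]; apply: HN => /=; rewrite patchE mem_set//= lee_fin.
  have := gF y Ay; have := ler_norm (F y); move: ry => /=.
  by move=> h1 h2 h3 h4; have := lt_le_trans h1 (le_trans h3 (le_trans h2 h4)); rewrite ltxx.
have := lebesgue_open_gt0 oU (conj Ax rg).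
by rewrite (subset_measure0 _ mN UN N0) ?ltxx//; exact: open_measurable_rV.
Qed.

Section Ck.
Variables (n : nat) (rho : R) (k : nat) (Phi : 'rV[R]_n -> R).
Hypothesis CkPhi : Ck_closure k (cube n rho) Phi.

Lemma Ck_continuous (s : seq 'I_n) x : (size s <= k)%N -> cube n rho x ->
  {for x, continuous (partials s Phi)}.
Proof.
move=> sk xc; have [_ _ /(_ s sk)[g cg gE]] := CkPhi.
have cgo : {within cube n rho, continuous g}.
  by apply: continuous_subspaceW cg; exact: subset_closure.
rewrite continuous_open_subspace in cgo; last exact: open_cube.
have gx := cgo x (mem_set xc).
have gpx : partials s Phi x = g x by rewrite gE// inE.
have nx : nbhs x (cube n rho).
  by apply: open_nbhs_nbhs; split => //; exact: open_cube.
have gn : {near nbhs x, g =1 partials s Phi}.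
  by apply: filterS nx => y yc; rewrite gE// inE.
suff : partials s Phi @ nbhs x --> g x by rewrite -gpx.
by apply: cvg_trans gx; exact: near_eq_cvg gn.
Qed.

Lemma Ck_bounded (s : seq 'I_n) : (size s <= k)%N ->
  exists M, forall x, cube n rho x -> `|partials s Phi x| <= M.
Proof.
move=> sk; have [_ _ /(_ s sk)[g cg gE]] := CkPhi.
have cK := continuous_compact cg (@compact_closure_cube n rho).
have [M [Mreal HM]] := compact_bounded cK.
exists (M + 1) => x xc; rewrite -gE ?inE//; apply: HM; first by rewrite ltrDl.
by exists x => //; exact: subset_closure.
Qed.

End Ck.
End row_vectors.

(** * Level sets along lines *)

Section regular_level_sets.
Context {R : realType}.

(** With cells shorter than e, distinct points have distinct cells. *)
Lemma apart_finite (lo hi e : R) (X : set R) : lo < hi -> 0 < e ->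
  (forall x, X x -> lo < x < hi) ->
  (forall x y, X x -> X y -> x < y -> e <= y - x) -> finite_set X.
Proof.
move=> lohi e0 XD sep; pose N := (Num.truncn ((hi - lo) / e)).+1.
have Ne : step lo hi N < e.
  by rewrite /step ltr_pdivrMr ?ltr0n// mulrC -ltr_pdivrMr// truncnS_gt.
have inj : {in X &, injective (cell lo hi N)}.
  move=> x y /set_mem Xx /set_mem Xy xy.
  have /andP[/ltW lx _] := XD x Xx; have /andP[/ltW ly _] := XD y Xy.
  have := cell_eq_dist lohi (ltn0Sn _) lx ly xy; rewrite -/N => /lt_trans/(_ Ne).
  rewrite ltr_norml; have [h|h|//] := ltgtP x y.
    by have := sep _ _ Xx Xy h; lra.
  by have := sep _ _ Xy Xx h; lra.
rewrite -(eq_finite_set (inj_card_eq inj)).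
apply: (sub_finite_set _ (finite_II N)) => _ [x /XD xD <-].
by apply: cell_lt => //; lra.
Qed.

Variables (d : nat) (rho M : R) (Phi : 'rV[R]_d.-1 -> R) (l : 'I_d).
Variables (xh : 'rV[R]_d.-1) (g : R -> R).
Let D t := - (2 * rho) < t < 2 * rho.
Let G t := append_last xh t ord0 l - Phi_at Phi l xh t.
Hypotheses (rho0 : 0 < rho) (M0 : 0 < M).
Hypothesis dG : forall t : R, D t -> is_derive t 1 G (g t).
Hypothesis gM : forall s t, D s -> D t -> `|g s - g t| <= M * `|s - t|.
Hypothesis rG : regular_on (- (2 * rho)) (2 * rho) G g.

Lemma X_setE : X_set rho Phi l xh = [set t | D t /\ G t = 0].
Proof.
apply/seteqP; split=> t [tD tE]; split => //; first by rewrite /G tE subrr.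
by move/eqP: tE; rewrite subr_eq0 => /eqP.
Qed.

Lemma Lambda_setE s : Lambda_set rho Phi l xh s =
  [set t | D t /\ 0 < (if s then (- G) else G) t].
Proof.
apply/seteqP; split=> t [tD]; case: s; rewrite ?expr1 ?expr0 ?mulN1r ?mul1r ?fctE => h;
  by split => //; move: h; rewrite /= ?fctE ?expr1 ?expr0 ?mulN1r ?mul1r /G; lra.
Qed.

Lemma regular_level_sets : [/\ finite_set (X_set rho Phi l xh),
  forall s : bool, X_set rho Phi l xh = X_endpoints rho Phi l xh s
  & forall s : bool, distinct_endpoints (Lambda_set rho Phi l xh s)].
Proof.
have dGs (s : bool) (t : R) : D t -> is_derive t 1 (if s then (- G) else G) ((if s then - g else g) t).
  by case: s => tD; [apply: is_deriveN; exact: dG|exact: dG].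
have rGs (s : bool) : regular_on (- (2 * rho)) (2 * rho) (if s then (- G) else G) (if s then - g else g).
  by case: s => //; exact: regular_onN.
split.
- have [e e0 sep] := regular_roots_apart dG rG M0 gM.
  rewrite X_setE; apply: (@apart_finite (- (2 * rho)) (2 * rho) e) => //.
  + by have := rho0; lra.
  + by move=> x [].
  + by move=> x y [xD Gx] [yD Gy]; exact: sep.
- move=> s; rewrite X_setE.
  have := roots_eq_endpoints (dGs s) (rGs s); rewrite -Lambda_setE /X_endpoints => <-.
  apply/seteqP; split=> t [tD]; case: s => //; rewrite fctE => Gt; split => //.
    by rewrite Gt oppr0.
  by apply/eqP; rewrite -oppr_eq0; apply/eqP.
- move=> s; rewrite Lambda_setE; exact: regular_distinct_endpoints (dGs s) (rGs s).
Qed.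

End regular_level_sets.

Section coordinates.
Context {R : realType} {n : nat}.

Lemma append_lastE d (xh : 'rV[R]_d) (t : R) (i : 'I_d) :
  append_last (d := d.+1) xh t ord0 (lift ord_max i) = xh ord0 i.
Proof.
rewrite mxE; case: insubP => [j _ ji|/negP[]]; last first.
  by have := ltn_ord i; rewrite -[X in (X < _)%N](lift_max i).
by congr (xh _ _); apply/val_inj; rewrite ji; exact: lift_max.
Qed.

Lemma append_last_max d (xh : 'rV[R]_d) (t : R) :
  append_last (d := d.+1) xh t ord0 ord_max = t.
Proof. by rewrite mxE insubF //= ltnn. Qed.

Lemma col'_append_last_max d (xh : 'rV[R]_d) (t : R) :
  col' ord_max (append_last (d := d.+1) xh t) = xh.
Proof. by apply/rowP => j; rewrite mxE append_lastE. Qed.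

Lemma col'_append_last (xh : 'rV[R]_n.+1) (t : R) (l : 'I_n.+1) :
  col' (lift ord_max l) (append_last (d := n.+2) xh t) =
  append_last (d := n.+1) (col' l xh) t.
Proof.
apply/rowP => j; rewrite mxE; have [i ->|->] := unliftP ord_max j.
  have E : lift (lift ord_max l) (lift ord_max i) = lift ord_max (lift l i) :> 'I_n.+2.
    apply/val_inj; rewrite /= /bump.
    have li := ltn_ord i; have ll := ltn_ord l.
    rewrite (leqNgt n i) li (leqNgt n.+1 l) ll /= !add0n.
    by case: (leqP l i) => _; rewrite ?add1n ?add0n leqNgt ?ltnS ?li ?(ltnW li)// ltnW.
  by rewrite E !append_lastE mxE.
have E : lift (lift ord_max l) ord_max = ord_max :> 'I_n.+2.
  apply/val_inj; rewrite /= /bump; have ll := ltn_ord l.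
  by rewrite (leqNgt n.+1 l) ll /= add0n -ltnS ll.
by rewrite E !append_last_max.
Qed.

Lemma cube_insert_coord (rho : R) (l : 'I_n.+1) c (y : 'rV[R]_n) :
  cube n.+1 rho (insert_coord l c y) <-> - (2 * rho) < c < 2 * rho /\ cube n rho y.
Proof.
split=> [H|[cD yc] i].
  split; first by have := H l; rewrite insert_coord_at.
  by move=> j; have := H (lift l j); rewrite insert_coord_lift.
by have [j ->|->] := unliftP l i; rewrite ?insert_coord_lift ?insert_coord_at.
Qed.

Lemma cube_append_last (rho : R) (y : 'rV[R]_n) t :
  cube n rho y -> - (2 * rho) < t < 2 * rho ->
  cube n.+1 rho (append_last (d := n.+1) y t).
Proof.
move=> yc tD i; have [j ->|->] := unliftP ord_max i.
  by rewrite append_lastE.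
by rewrite append_last_max.
Qed.

Lemma measurable_append_last (t : R) :
  measurable_fun [set: 'rV[R]_n] (fun y => append_last (d := n.+1) y t).
Proof.
apply: measurable_fun_rV => i; have [j ->|->] := unliftP ord_max i.
  by under eq_fun do rewrite append_lastE; exact: measurable_coord.
by under eq_fun do rewrite append_last_max; exact: measurable_cst.
Qed.

Lemma measurable_col' (l : 'I_n.+1) :
  measurable_fun [set: 'rV[R]_n.+1] (fun x : 'rV[R]_n.+1 => col' l x).
Proof.
apply: measurable_fun_rV => i; under eq_fun do rewrite mxE.
exact: measurable_coord.
Qed.

Lemma append_last_line (y : 'rV[R]_n) t h :
  append_last (d := n.+1) y (h *: (1 : R) + t) =
  h *: delta_mx ord0 ord_max + append_last (d := n.+1) y t.
Proof.
apply/rowP => i; rewrite [RHS]mxE [in RHS]mxE [delta_mx _ _ _ _]mxE eqxx /=.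
have [j ->|->] := unliftP ord_max i.
  by rewrite !append_lastE eq_sym (negbTE (neq_lift _ _)) mulr0 add0r.
by rewrite !append_last_max eqxx.
Qed.

(** Both derivatives are limits of the same difference quotients. *)
Lemma is_derive_append_last (g : 'rV[R]_n.+1 -> R) (y : 'rV[R]_n) (t : R) :
  derivable g (append_last (d := n.+1) y t) (delta_mx ord0 ord_max) ->
  is_derive t 1 (fun t : R => g (append_last (d := n.+1) y t))
    (partial ord_max g (append_last (d := n.+1) y t)).
Proof.
set x := append_last _ _ => dg.
have E : (fun h : R => h^-1 *: ((g \o shift x) (h *: delta_mx ord0 ord_max) - g x)) =
   (fun h : R => h^-1 *: (((fun t : R => g (append_last (d := n.+1) y t)) \o shift t) (h *: (1 : R)) - g x)).
  by apply/funext => h; rewrite /= append_last_line.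
by apply: DeriveDef; [move: dg; rewrite /derivable E|rewrite /partial /derive E].
Qed.

End coordinates.

Section lines.
Context {R : realType} {n : nat}.
Variables (rho : R) (Phi : 'rV[R]_n.+1 -> R).
Hypothesis rho0 : 0 < rho.
Hypothesis C3 : Ck_closure 3 (cube n.+1 rho) Phi.

(** The k-th derivative of the restriction of Phi to a line parallel to the last
    axis. *)
Definition line k (y : 'rV[R]_n) (t : R) : R :=
  partials (nseq k ord_max) Phi (append_last (d := n.+1) y t).

Let D (t : R) := - (2 * rho) < t < 2 * rho.

Lemma line_is_derive k y t : (k < 3)%N -> cube n rho y -> D t ->
  is_derive t 1 (line k y) (line k.+1 y t).
Proof.
move=> k3 yc tD; apply: is_derive_append_last.
have [_ dP _] := C3; apply: dP; first by rewrite size_nseq.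
exact: cube_append_last.
Qed.

Lemma line_continuous k y t : (k < 3)%N -> cube n rho y -> D t ->
  {for t, continuous (line k y)}.
Proof.
move=> k3 yc tD; have [dl _] := line_is_derive k3 yc tD.
exact/differentiable_continuous/derivable1_diffP.
Qed.

Lemma line_bounded k : (k <= 3)%N ->
  exists2 M, 0 < M & forall y t, cube n rho y -> D t -> `|line k y t| <= M.
Proof.
move=> k3; have [|M HM] := @Ck_bounded R n.+1 rho 3 Phi C3 (nseq k ord_max).
  by rewrite size_nseq.
exists (Num.max M 1); first by rewrite lt_max ltr01 orbT.
move=> y t yc tD; apply: (le_trans (HM _ (cube_append_last yc tD))).
by rewrite le_max lexx.
Qed.

Lemma line_le_Linfty k y t : (k <= 3)%N -> cube n rho y -> D t ->
  (`|line k y t|%:E <= Linfty_norm (cube n.+1 rho) (grad_norm k Phi))%E.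
Proof.
move=> k3 yc tD.
apply: (le_Linfty_norm (g := partials (nseq k ord_max) Phi) (@open_cube R n.+1 rho)).
- by move=> x xc; apply: (Ck_continuous C3) => //; rewrite size_nseq.
- move=> x _; rewrite -sqrtr_sqr; apply: ler_wsqrtr.
  rewrite (bigD1 [tuple of nseq k ord_max])//= lerDl sumr_ge0// => s _.
  exact: sqr_ge0.
- exact: cube_append_last.
Qed.

Lemma measurable_line k t : (k <= 3)%N -> D t ->
  measurable_fun (cube n rho) (line k ^~ t).
Proof.
move=> k3 tD.
apply: (@measurable_comp _ _ _ _ _ _ (cube n.+1 rho)).
- exact: measurable_cube.
- by move=> _ [y yc <-]; exact: cube_append_last.
- apply: measurable_fun_continuous_rV; first exact: open_cube.
  by move=> x xc; apply: (Ck_continuous C3) => //; rewrite size_nseq.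
- by apply: measurable_funTS; exact: measurable_append_last.
Qed.

End lines.

Section slices.
Context {R : realType} {n : nat}.
Variables (rho : R) (Phi : 'rV[R]_n.+1 -> R) (l : 'I_n.+1).
Hypothesis rho0 : 0 < rho.
Hypothesis C3 : Ck_closure 3 (cube n.+1 rho) Phi.

Let lo : R := - (2 * rho).
Let hi : R := 2 * rho.
Let lohi : lo < hi. Proof. by have := rho0; rewrite /lo /hi => ?; lra. Qed.
Let K := cube n.+1 rho : set 'rV[R]_n.+1.
Let mK : measurable K. Proof. exact: measurable_cube. Qed.

Let F (x : 'rV[R]_n.+1) (t : R) : R := line Phi 0 (col' l x) t - x ord0 l.
Let f (x : 'rV[R]_n.+1) (t : R) : R := line Phi 1 (col' l x) t.
Let X (x : 'rV[R]_n.+1) := X_set (d := n.+2) rho Phi (lift ord_max l) x.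

(** The points over which the level of Phi is taken transversally. The deleted
    coordinate x l enters F as a constant. *)
Definition good_points := [set x | K x /\ regular_on lo hi (F x) (f x)].

Let K_col' x : K x -> cube n rho (col' l x).
Proof. by rewrite -{1}(insert_coord_col' l x) => /cube_insert_coord[]. Qed.

Let Phi_atE x t : Phi_at (d := n.+2) Phi (lift ord_max l) x t = line Phi 0 (col' l x) t.
Proof. by rewrite /Phi_at col'_append_last. Qed.

Let XE x : X x = roots lo hi F x.
Proof.
apply/seteqP; split=> t [tD tE]; split => //.
  by move: tE; rewrite Phi_atE append_lastE /F => ->; rewrite subrr.
by rewrite Phi_atE append_lastE; move/eqP: tE; rewrite subr_eq0 => /eqP.
Qed.

Let mline k t : (k <= 3)%N -> lo < t < hi ->
  measurable_fun K (fun x => line Phi k (col' l x) t).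
Proof.
move=> k3 tD.
apply: (@measurable_comp _ _ _ _ _ _ (cube n rho) (line Phi k ^~ t)).
- exact: measurable_cube.
- by move=> _ [x Kx <-]; exact: K_col'.
- exact: (measurable_line C3 k3 tD).
- by apply: measurable_funTS; exact: measurable_col'.
Qed.

Let mF t : lo < t < hi -> measurable_fun K (F^~ t).
Proof.
move=> tD; apply: measurable_funB; first exact: mline.
by apply: measurable_funTS; exact: measurable_coord.
Qed.

Let mf t : lo < t < hi -> measurable_fun K (f^~ t).
Proof. by move=> tD; exact: mline. Qed.

Let cF x t : K x -> lo < t < hi -> {for t, continuous (F x)}.
Proof.
move=> Kx tD; apply: continuousB; last exact: cst_continuous.
exact: (line_continuous C3 (isT : (0 < 3)%N) (K_col' Kx) tD).
Qed.

Let cf x t : K x -> lo < t < hi -> {for t, continuous (f x)}.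
Proof. by move=> Kx tD; exact: (line_continuous C3 (isT : (1 < 3)%N) (K_col' Kx) tD). Qed.

Lemma measurable_good_points : measurable good_points.
Proof. exact: measurable_regular. Qed.

Let f_lip x : K x -> exists2 M, 0 < M &
  forall s t, lo < s < hi -> lo < t < hi -> `|f x s - f x t| <= M * `|s - t|.
Proof.
move=> /K_col' yc; have [M M0 HM] := line_bounded C3 (isT : (2 <= 3)%N).
exists M => // s t sD tD.
apply: (@bounded_deriv_lipschitz R (fun u => lo < u < hi) (f x)
  (line Phi 2 (col' l x)) M) => [a b u aD bD abu|u uD|u uD||].
- by lra.
- exact: (line_is_derive C3 (isT : (1 < 3)%N) yc uD).
- exact: (HM _ _ yc uD).
- exact: sD.
- exact: tD.
Qed.

Lemma good_level_sets x : good_points x ->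
  [/\ finite_set (X x),
      forall s : bool, X x = X_endpoints (d := n.+2) rho Phi (lift ord_max l) x s
    & forall s : bool, distinct_endpoints (Lambda_set (d := n.+2) rho Phi (lift ord_max l) x s)].
Proof.
move=> [Kx rx]; have yc := K_col' Kx; have [M M0 fM] := f_lip Kx.
have GE : (fun t => append_last (d := n.+2) x t ord0 (lift ord_max l) -
    Phi_at (d := n.+2) Phi (lift ord_max l) x t) = - F x.
  by apply/funext => t; rewrite append_lastE Phi_atE fctE /F opprB.
apply: (@regular_level_sets R n.+2 rho M Phi (lift ord_max l) x (- f x)) => //.
- move=> t tD; rewrite GE; apply: is_deriveN.
  have dl := line_is_derive C3 (isT : (0 < 3)%N) yc tD.
  by rewrite -[f x t]subr0; apply: is_deriveB.
- by move=> s t sD tD; rewrite !fctE -opprD normrN; exact: fM.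
- by rewrite GE; exact: regular_onN.
Qed.

(** For each line, a bad value of the coordinate l is an almost critical value, so
    the slices are null by Sard's theorem. *)
Lemma bad_points_null : lebesgue_rV n.+1 (K `\` good_points) = 0%E.
Proof.
set B := K `\` _.
have mB : measurable B by apply: measurableD => //; exact: measurable_good_points.
have [M M0 HM] := line_bounded C3 (isT : (2 <= 3)%N).
have -> : lebesgue_rV n.+1 B = (\int[lebesgue_rV n.+1]_x (\1_B x)%:E)%E.
  by rewrite integral_indic// setIT.
rewrite (integral_insert_coord l); last 2 first.
- by apply/measurable_EFinP; exact: measurable_indic.
- by move=> x; rewrite lee_fin.
apply: integral0_eq => y _.
pose By := [set c | B (insert_coord l c y)].
have mins : measurable_fun [set: measurableTypeR R] (fun c => insert_coord l c y).
  apply: measurable_fun_rV => i; have [j ->|->] := unliftP l i.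
    by under eq_fun do rewrite insert_coord_lift; exact: measurable_cst.
  by under eq_fun do rewrite insert_coord_at; move=> _ Y mY; rewrite setTI.
have mBy : measurable By.
  by rewrite -[X in measurable X]setTI; exact: (mins measurableT _ mB).
rewrite (_ : (fun c => _) = (fun c => (\1_By c)%:E)); last first.
  apply/funext => c; rewrite !indicE.
  by have -> : (c \in By) = (insert_coord l c y \in B)
    by apply/idP/idP => /set_mem H; apply/mem_set.
rewrite integral_indic// setIT.
have [yc|nyc] := pselect (cube n rho y); last first.
  rewrite (_ : By = set0) ?measure0// -subset0 => c [Kc _].
  by apply: nyc; have /cube_insert_coord[] := Kc.
apply: (@sard_null R rho M (line Phi 0 y) (line Phi 1 y) (line Phi 2 y) rho0
  _ _ _ By mBy) => [t tD|t tD|t tD|].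
- exact: (line_is_derive C3 (isT : (0 < 3)%N) yc tD).
- exact: (line_is_derive C3 (isT : (1 < 3)%N) yc tD).
- exact: (HM _ _ yc tD).
move=> c [Kc nG] rc; apply: nG; split => //.
have FE : F (insert_coord l c y) = (fun t => line Phi 0 y t - c).
  by apply/funext => t; rewrite /F col'_insert_coord insert_coord_at.
by rewrite FE /f col'_insert_coord.
Qed.

Lemma mdelta_ge0 delta (Y : set R) : 0 <= mdelta rho delta Y.
Proof.
rewrite /mdelta; case: ifP => _; first exact: powR_ge0.
by rewrite fsumr_ge0// => i _; exact: powR_ge0.
Qed.

Let g delta x := mdelta rho delta (X x) * \1_good_points x.

Lemma measurable_mdelta_good delta : measurable_fun K (g delta).
Proof.
have := @measurable_mdelta_roots _ _ R K mK lo hi lohi F f mF mf cF cf rho delta rho0.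
rewrite /g /good_points => H; under eq_fun do rewrite XE.
apply: H => x Kx rx; rewrite -XE; have [] := good_level_sets (conj Kx rx).
by [].
Qed.

Lemma ae_good (P : 'rV[R]_n.+1 -> Prop) : (forall x, good_points x -> P x) ->
  {ae lebesgue_rV n.+1, forall x, K x -> P x}.
Proof.
move=> gP; exists (K `\` good_points); split.
- by apply: measurableD => //; exact: measurable_good_points.
- exact: bad_points_null.
- move=> x /= nP; split.
    by apply: contrapT => nK; apply: nP.
  by move=> gx; apply: nP => _; exact: gP.
Qed.

(** Fubini along the coordinate l reduces the bound to one level set of the
    restriction of Phi to each line. *)
Lemma integral_mdelta_slices (delta M2 M3 : R) : 0 < delta -> delta < 2 ->
  (forall y t, cube n rho y -> lo < t < hi -> `|line Phi 2 y t| <= M2) ->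
  (forall y t, cube n rho y -> lo < t < hi -> `|line Phi 3 y t| <= M3) ->
  (\int[lebesgue_rV n.+1]_(x in K) (mdelta rho delta (X x))%:E <=
   ((4 * rho) ^+ n * ((4 * rho) `^ (1 - delta) *
     (1 + 16 * 2 `^ delta / (1 - 2 `^ delta / 4) *
        (4 * rho * M2 + 3 * (4 * rho) ^+ 2 * M3))))%:E)%E.
Proof.
move=> de0 de2 HM2 HM3; set B1 := _ `^ _ * _.
have g0 x : 0 <= g delta x by rewrite mulr_ge0 ?mdelta_ge0// indicE.
have mg := measurable_mdelta_good delta.
have mgE : measurable_fun K (fun x => (g delta x)%:E) by exact/measurable_EFinP.
have le1 : (\int[lebesgue_rV n.+1]_(x in K) (mdelta rho delta (X x))%:E <=
    \int[lebesgue_rV n.+1]_(x in K) (g delta x)%:E)%E.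
  apply: ae_ge0_le_integral_sup => //.
  - by move=> x _; rewrite lee_fin mdelta_ge0.
  - by move=> x _; rewrite lee_fin g0.
  - by apply: ae_good => x gx; rewrite lee_fin /g indicE mem_set// mulr1.
apply: (le_trans le1); rewrite integral_mkcond.
rewrite (integral_insert_coord l); last 2 first.
- exact: ((measurable_restrictT (fun x => (g delta x)%:E) mK).1 mgE).
- by move=> x; apply: erestrict_ge0 => z _; rewrite lee_fin g0.
have slice y : (\int[lebesgue_measure]_c ((fun x => (g delta x)%:E) \_ K) (insert_coord l c y) <=
    ((EFin \o cst B1) \_ (cube n rho)) y)%E.
  have [yc|nyc] := pselect (cube n rho y); last first.
    rewrite patchN ?notin_setE// integral0_eq// => c _.
    by rewrite patchN// notin_setE => /cube_insert_coord[].
  rewrite patchT ?inE//=.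
  pose gy c := g delta (insert_coord l c y).
  rewrite (_ : (fun c => _) = ((fun c => (gy c)%:E) \_ [set c | lo < c < hi])); last first.
    apply/funext => c; rewrite !patchE; case: ifPn => [/set_mem/cube_insert_coord[cD _]|nK].
      by rewrite mem_set.
    rewrite ifF//; apply/negP => /set_mem cD; move/negP: nK; apply; apply/mem_set.
    exact/cube_insert_coord.
  rewrite -integral_mkcond.
  have mins : measurable_fun [set c | lo < c < hi] (fun c => insert_coord l c y).
    apply: measurable_funTS; apply: measurable_fun_rV => i; have [j ->|->] := unliftP l i.
      by under eq_fun do rewrite insert_coord_lift; exact: measurable_cst.
    by under eq_fun do rewrite insert_coord_at; move=> _ Y mY; rewrite setTI.
  have mD : measurable ([set c | lo < c < hi] : set R).
    rewrite (_ : [set c | _] = [set` `]lo, hi[]); first exact: measurable_itv.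
    by apply/seteqP; split => c; rewrite /= in_itv.
  have H := @int_mdelta_level R rho M2 M3 (line Phi 0 y) (line Phi 1 y) (line Phi 2 y)
    (line Phi 3 y) rho0 (fun t tD => line_is_derive C3 (isT : (0 < 3)%N) yc tD)
    (fun t tD => line_is_derive C3 (isT : (1 < 3)%N) yc tD)
    (fun t tD => line_is_derive C3 (isT : (2 < 3)%N) yc tD)
    (fun t tD => HM2 y t yc tD) (fun t tD => HM3 y t yc tD) delta gy de0 de2.
  have [||c cD|//] := H.
  - apply: (@measurable_comp _ _ _ _ _ _ K (g delta)) => //.
    by move=> _ [c cD <-]; exact/cube_insert_coord.
  - by move=> c cD; exact: g0.
  have [gc|ngc] := pselect (good_points (insert_coord l c y)); last first.
    by left; rewrite /gy /g indicE memNset// mulr0.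
  right; rewrite /gy /g indicE mem_set// mulr1.
  have lE : X (insert_coord l c y) = [set t | lo < t < hi /\ line Phi 0 y t = c].
    rewrite XE; apply/seteqP; split=> t [tD tE]; split => //.
      by move/eqP: tE; rewrite /F col'_insert_coord insert_coord_at subr_eq0 => /eqP.
    by rewrite /F col'_insert_coord insert_coord_at tE subrr.
  have [fin _ _] := good_level_sets gc; split; [by rewrite lE|by rewrite -lE|].
  have [Kc rc] := gc; have [M M0 fM] := f_lip Kc.
  have dF t : lo < t < hi -> is_derive t 1 (F (insert_coord l c y)) (f (insert_coord l c y) t).
    move=> tD; rewrite -[f _ t]subr0; apply: is_deriveB.
    apply: (line_is_derive C3 (isT : (0 < 3)%N)) => //.
    by rewrite col'_insert_coord.
  have [e e0 sep] := regular_roots_apart dF rc M0 fM.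
  exists e => // s t; rewrite -lE XE => -[sD Fs] [tD Ft].
  rewrite neq_lt => /orP[st|ts]; last first.
    by rewrite gtr0_norm ?subr_gt0//; exact: sep.
  by rewrite distrC gtr0_norm ?subr_gt0//; exact: sep.
have B10 : 0 <= B1.
  have c0 : cube n rho (0 : 'rV[R]_n) by move=> i; rewrite mxE; have := lohi; rewrite /lo /hi => ?; lra.
  have : (0%R%:E <= ((EFin \o cst B1) \_ (cube n rho)) (0%R : 'rV[R]_n))%E.
    apply: le_trans (slice 0); apply: integral_ge0 => c _.
    by apply: erestrict_ge0 => z _; rewrite lee_fin g0.
  by rewrite patchT ?inE//= lee_fin.
apply: (@le_trans _ _ (\int[lebesgue_rV n]_y ((EFin \o cst B1) \_ (cube n rho)) y)%E).
  apply: ae_ge0_le_integral_sup => //.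
  - by move=> y _; apply: integral_ge0 => c _; apply: erestrict_ge0 => z _; rewrite lee_fin g0.
  - by move=> y _; apply: erestrict_ge0.
  - apply: ((measurable_restrictT (EFin \o cst B1) (@measurable_cube R n rho)).1 _).
    by apply/measurable_EFinP; exact: measurable_cst.
  - by apply: aeW => y _; exact: slice.
rewrite -integral_mkcond (eq_integral (cst B1%:E))// integral_cst; last first.
  exact: (@measurable_cube R n rho).
have -> : (B1%:E * lebesgue_rV n (cube n rho))%E = (B1%:E * ((4 * rho) ^+ n)%:E)%E.
  by congr (_ * _)%E; exact: lebesgue_rV_cube.
by rewrite -EFinM lee_fin mulrC.
Qed.

End slices.

Section last_coordinate.
Context {R : realType} {n : nat}.
Variables (rho : R) (Phi : 'rV[R]_n.+1 -> R).
Hypothesis rho0 : 0 < rho.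

Let Phi_atE xh t : Phi_at (d := n.+2) Phi ord_max xh t = Phi xh.
Proof. by rewrite /Phi_at col'_append_last_max. Qed.

(** The equation is t = Phi xh, and t - Phi xh has derivative 1. *)
Lemma last_level_sets xh :
  [/\ finite_set (X_set (d := n.+2) rho Phi ord_max xh),
      forall s : bool, X_set (d := n.+2) rho Phi ord_max xh =
        X_endpoints (d := n.+2) rho Phi ord_max xh s
    & forall s : bool, distinct_endpoints (Lambda_set (d := n.+2) rho Phi ord_max xh s)].
Proof.
have GE : (fun t => append_last (d := n.+2) xh t ord0 ord_max -
    Phi_at (d := n.+2) Phi ord_max xh t) = (fun t => t - Phi xh).
  by apply/funext => t; rewrite append_last_max Phi_atE.
apply: (@regular_level_sets R n.+2 rho 1 Phi ord_max xh (fun=> 1)) => //.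
- move=> t _; rewrite GE -[X in is_derive _ _ _ X]subr0.
  exact: is_deriveB.
- by move=> s t _ _; rewrite subrr normr0 mul1r.
- by rewrite GE; exists 1 => // t _; rewrite normr1 lerDr.
Qed.

Lemma last_mdelta delta xh :
  mdelta rho delta (X_set (d := n.+2) rho Phi ord_max xh) = (4 * rho) `^ (- delta).
Proof.
have XE : X_set (d := n.+2) rho Phi ord_max xh `<=` [set Phi xh].
  by move=> t [_]; rewrite Phi_atE append_last_max => ->.
have [->|/set0P[t Xt]] := eqVneq (X_set (d := n.+2) rho Phi ord_max xh) set0.
  by rewrite /mdelta eqxx.
have -> : X_set (d := n.+2) rho Phi ord_max xh = [set Phi xh].
  by apply/seteqP; split => // _ ->; rewrite -(XE _ Xt).
rewrite mdelta_finite; [|exact: finite_set1|by exists (Phi xh)].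
by rewrite fset_set1 big_seq_fset1 gap_set1// setDv.
Qed.

End last_coordinate.

Theorem theorem13p1 (R : realType) (d : nat) (hd : (2 <= d)%N) :
  (forall (rho : R) (Phi : 'rV[R]_d.-1 -> R) (l : 'I_d),
     0 < rho -> Ck_closure 3 (cube d.-1 rho) Phi ->
     {ae lebesgue_rV d.-1, forall xh, cube d.-1 rho xh ->
       [/\ finite_set (X_set rho Phi l xh),
           forall s : bool, X_set rho Phi l xh = X_endpoints rho Phi l xh s
         & forall s : bool, distinct_endpoints (Lambda_set rho Phi l xh s)]})
  /\
  (forall delta : R, 0 < delta -> delta < 2 ->
     exists C : R,
       forall (rho : R) (Phi : 'rV[R]_d.-1 -> R) (l : 'I_d),
         0 < rho -> Ck_closure 3 (cube d.-1 rho) Phi ->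
         ae_measurable (lebesgue_rV d.-1) (cube d.-1 rho)
           (fun xh => mdelta rho delta (X_set rho Phi l xh)) /\
         (\int[lebesgue_rV d.-1]_(xh in cube d.-1 rho)
             (mdelta rho delta (X_set rho Phi l xh))%:E
          <= (C * rho `^ (d.-1%:R - delta))%:E *
             (1 + rho%:E * Linfty_norm (cube d.-1 rho) (grad_norm 2 Phi)
                + (rho ^+ 2)%:E *
                  Linfty_norm (cube d.-1 rho) (grad_norm 3 Phi)))%E).
Proof.
case: d hd => [//|[//|n]] _ /=; split.
  move=> rho Phi l rho0 C3; have [l' ->|->] := unliftP ord_max l.
    by apply: (ae_good rho0 C3) => x; exact: good_level_sets.
  by apply: aeW => xh _; exact: last_level_sets.
move=> delta de0 de2.
(* Q is the constant of the one-dimensional bound for length 4 * rho; the factor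
   48 is 3 * 4 ^+ 2 *)
pose Q : R := 16 * 2 `^ delta / (1 - 2 `^ delta / 4).
have Q0 : 0 <= Q.
  rewrite divr_ge0 ?mulr_ge0 ?powR_ge0//.
  have : 2 `^ delta <= 2 `^ 2%:R :> R by rewrite ler_powR ?ler1n// ltW.
  by rewrite powR_mulrn// => h; rewrite subr_ge0 ler_pdivrMr//; lra.
pose C : R := 4 `^ (n.+1%:R - delta) * (1 + 48 * Q).
have C0 : 0 < C by rewrite mulr_gt0 ?powR_gt0// ltr_wpDr// mulr_ge0.
exists C => rho Phi l rho0 C3.
set L2 := Linfty_norm _ (grad_norm 2 Phi); set L3 := Linfty_norm _ (grad_norm 3 Phi).
have L20 : (0 <= L2)%E by exact: Lnorm_ge0.
have L30 : (0 <= L3)%E by exact: Lnorm_ge0.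
have scale : (4 * rho) ^+ n.+1 * (4 * rho) `^ (- delta) =
    4 `^ (n.+1%:R - delta) * rho `^ (n.+1%:R - delta).
  rewrite -powRM ?ltW// powRD ?powR_mulrn ?mulr_ge0 ?ltW//.
  by apply/implyP => _; rewrite gt_eqF// mulr_gt0.
have Crho0 : 0 < C * rho `^ (n.+1%:R - delta) by rewrite mulr_gt0// powR_gt0.
have rho2 : 0 < rho ^+ 2 by rewrite exprn_gt0.
(* an infinite norm makes the bound trivial *)
have finite_case (I : \bar R) : (forall r2 r3, L2 = r2%:E -> L3 = r3%:E ->
      (I <= (C * rho `^ (n.+1%:R - delta) * (1 + rho * r2 + rho ^+ 2 * r3))%:E)%E) ->
    (I <= (C * rho `^ (n.+1%:R - delta))%:E * (1 + rho%:E * L2 + (rho ^+ 2)%:E * L3))%E.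
  move: L20 L30; case: L2 => [r2 r20||//]; case: L3 => [r3 r30||//].
  - by move=> /(_ r2 r3 erefl erefl); rewrite !EFinM !EFinD !EFinM.
  - by move=> _ _; rewrite gt0_muley ?lte_fin// addey// gt0_muley ?lte_fin// leey.
  - by move=> _ _; rewrite gt0_muley ?lte_fin// addey// addye// gt0_muley ?lte_fin// leey.
  - by move=> _ _ _; rewrite !gt0_muley ?lte_fin// leey.
have [l' ->|->] := unliftP ord_max l; split.
- exists (fun x => mdelta rho delta (X_set (d := n.+2) rho Phi (lift ord_max l') x) *
    \1_(good_points rho Phi l') x); first exact: (measurable_mdelta_good _ rho0 C3).
  by apply: (ae_good (l := l') rho0 C3) => x gx; rewrite indicE mem_set// mulr1.
- apply: finite_case => r2 r3 E2 E3.
  have HM2 y t : cube n rho y -> - (2 * rho) < t < 2 * rho -> `|line Phi 2 y t| <= r2.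
    by move=> yc tD; rewrite -lee_fin -E2; exact: (line_le_Linfty C3).
  have HM3 y t : cube n rho y -> - (2 * rho) < t < 2 * rho -> `|line Phi 3 y t| <= r3.
    by move=> yc tD; rewrite -lee_fin -E3; exact: (line_le_Linfty C3).
  apply: (le_trans (integral_mdelta_slices l' rho0 C3 de0 de2 HM2 HM3)).
  have r20 : 0 <= r2 by rewrite -lee_fin -E2.
  have r30 : 0 <= r3 by rewrite -lee_fin -E3.
  rewrite lee_fin mulrA (_ : (4 * rho) ^+ n * _ = (4 * rho) ^+ n.+1 * (4 * rho) `^ (- delta)); last first.
    rewrite powRD; last by apply/implyP => _; rewrite gt_eqF// mulr_gt0.
    by rewrite powRr1 ?mulr_ge0 ?ltW// mulrA -exprSr.
  rewrite scale -/Q (_ : C * _ * _ = 4 `^ (n.+1%:R - delta) * rho `^ (n.+1%:R - delta) *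
    ((1 + 48 * Q) * (1 + rho * r2 + rho ^+ 2 * r3))); last by rewrite /C; ring.
  apply: ler_wpM2l; first by rewrite mulr_ge0 ?powR_ge0.
  have a0 : 0 <= rho * r2 by rewrite mulr_ge0// ltW.
  have b0 : 0 <= rho ^+ 2 * r3 by rewrite mulr_ge0// ltW.
  rewrite (_ : 4 * rho * r2 + _ = 4 * (rho * r2) + 48 * (rho ^+ 2 * r3)); last by ring.
  move: (rho * r2) (rho ^+ 2 * r3) a0 b0 => a b a0 b0.
  by have := mulr_ge0 Q0 a0; have := mulr_ge0 Q0 b0; have := Q0; lra.
- exists (fun=> (4 * rho) `^ (- delta)); first exact: measurable_cst.
  by apply: aeW => x _; rewrite last_mdelta.
- apply: finite_case => r2 r3 E2 E3.
  have r20 : 0 <= r2 by rewrite -lee_fin -E2.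
  have r30 : 0 <= r3 by rewrite -lee_fin -E3.
  rewrite (eq_integral (cst ((4 * rho) `^ (- delta))%:E)); last first.
    by move=> x _; rewrite last_mdelta.
  rewrite integral_cst; last exact: (@measurable_cube R n.+1 rho).
  have -> : (((4 * rho) `^ (- delta))%:E * lebesgue_rV n.+1 (cube n.+1 rho) =
      ((4 * rho) `^ (- delta))%:E * ((4 * rho) ^+ n.+1)%:E)%E.
    by congr (_ * _)%E; exact: lebesgue_rV_cube.
  rewrite -EFinM lee_fin mulrC scale (_ : C * _ * _ = 4 `^ (n.+1%:R - delta) *
    rho `^ (n.+1%:R - delta) * ((1 + 48 * Q) * (1 + rho * r2 + rho ^+ 2 * r3))); last first.
    by rewrite /C; ring.
  have a0 : 0 <= rho * r2 by rewrite mulr_ge0// ltW.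
  have b0 : 0 <= rho ^+ 2 * r3 by rewrite mulr_ge0// ltW.
  rewrite ler_peMr ?mulr_ge0 ?powR_ge0//.
  move: (rho * r2) (rho ^+ 2 * r3) a0 b0 => a b a0 b0.
  by have := mulr_ge0 Q0 a0; have := mulr_ge0 Q0 b0; have := Q0; lra.
Qed.
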